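(* Let $n\in\omega$ and let $P,Q\leq \mathrm{Sym}(\mathbb{N})$ be Polish permutation groups. If the algebraic dimension of $Q$ is at most $n$, and $P$ is locally finite and $(n+1)$-free, then $E(P)$ is generically $E_{\mathrm{inj}}(Q)$-ergodic. In particular, $E(P)\not\leq_B E_{\mathrm{inj}}(Q)$.
   Context: A Polish permutation group is a closed subgroup of $\mathrm{Sym}(\mathbb{N})$ (pointwise convergence topology). For $P\leq\mathrm{Sym}(\mathbb{N})$ and $A\subseteq\mathbb{N}$, $P_A$ denotes the pointwise stabilizer of $A$, and $[A]_P:=\{a\in\mathbb{N}: \text{the orbit } P_A\cdot a \text{ is finite}\}$. The algebraic dimension of $P$ is the smallest $n\in\omega\cup\{\infty\}$ such that for every $A\subseteq\mathbb{N}$ with $|A|=n+1$ there is $a\in A$ with $a\in[A\setminus\{a\}]_P$. $P$ is locally finite if $[A]_P$ is finite for every finite $A\subseteq\mathbb{N}$. $P$ is $n$-free if for every finite $A\subseteq\mathbb{N}$ there are $g_0,\dots,g_{n-1}\in P$ such that for every $i<n$, the sets $[g_i\cdot A]_P$ and $[\bigcup_{j\neq i} g_j\cdot A]_P$ are disjoint. The Bernoulli shift of $P$ is the action of $P$ on $\mathbb{R}^{\mathbb{N}}$ given by $(gx)(a)=x(g^{-1}(a))$; $E(P)$ is its orbit equivalence relation, and $E_{\mathrm{inj}}(P)$ is the restriction of $E(P)$ to the invariant set $\mathrm{Inj}(\mathbb{N},\mathbb{R})$ of injective sequences. For analytic equivalence relations $E$ on $X$ and $F$ on $Y$ (Polish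 spaces), $E$ is generically $F$-ergodic if every Baire-measurable map $f:X\to Y$ with $x\,E\,x'\Rightarrow f(x)\,F\,f(x')$ maps a comeager subset of $X$ into a single $F$-class. $E\leq_B F$ means there is a Borel $f:X\to Y$ with $x\,E\,x'\iff f(x)\,F\,f(x')$. *)

(* Defs.v *)
From Stdlib Require Import Reals List Arith Classical.
Open Scope R_scope.

Definition is_perm (g : nat -> nat) : Prop :=
  exists h : nat -> nat, forall x, h (g x) = x /\ g (h x) = x.

Record polish_perm_group (P : (nat -> nat) -> Prop) : Prop := {
  ppg_perm : forall g, P g -> is_perm g;
  ppg_id : P (fun x => x);
  ppg_comp : forall g h, P g -> P h -> P (fun x => g (h x));
  ppg_inv : forall g, P g -> exists h, P h /\ forall x, h (g x) = x /\ g (h x) = x;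
  ppg_closed : forall g, is_perm g ->
      (forall n : nat, exists h, P h /\ forall i, (i < n)%nat -> h i = g i) -> P g }.

Definition finite_nat (S : nat -> Prop) : Prop :=
  exists l : list nat, forall a, S a -> In a l.

Definition stab (P : (nat -> nat) -> Prop) (A : nat -> Prop) (g : nat -> nat) : Prop :=
  P g /\ forall a, A a -> g a = a.

Definition orbit (G : (nat -> nat) -> Prop) (a : nat) : nat -> Prop :=
  fun b => exists g, G g /\ b = g a.

Definition acl (P : (nat -> nat) -> Prop) (A : nat -> Prop) : nat -> Prop :=
  fun a => finite_nat (orbit (stab P A) a).

Definition alg_dim_prop (P : (nat -> nat) -> Prop) (m : nat) : Prop :=
  forall l : list nat, NoDup l -> length l = S m ->
    exists a, In a l /\ acl P (fun b => In b l /\ b <> a) a.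

(** Algebraic dimension (the least such m, in omega U {oo}) is at most n. *)
Definition alg_dim_le (P : (nat -> nat) -> Prop) (n : nat) : Prop :=
  exists m, (m <= n)%nat /\ alg_dim_prop P m.

Definition locally_finite (P : (nat -> nat) -> Prop) : Prop :=
  forall A : nat -> Prop, finite_nat A -> finite_nat (acl P A).

Definition img (g : nat -> nat) (A : nat -> Prop) : nat -> Prop :=
  fun b => exists a, A a /\ b = g a.

Definition n_free (P : (nat -> nat) -> Prop) (n : nat) : Prop :=
  forall A : nat -> Prop, finite_nat A ->
    exists gs : nat -> nat -> nat,
      (forall i, (i < n)%nat -> P (gs i)) /\
      forall i, (i < n)%nat -> forall a,
        ~ (acl P (img (gs i) A) a /\
           acl P (fun b => exists j, (j < n)%nat /\ j <> i /\ img (gs j) A b) a).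

Definition RN := nat -> R.

Definition open_RN (U : RN -> Prop) : Prop :=
  forall x, U x -> exists (k : nat) (eps : R), 0 < eps /\
    forall y, (forall i, (i < k)%nat -> Rabs (y i - x i) < eps) -> U y.

Definition interior_empty (S : RN -> Prop) : Prop :=
  forall U, open_RN U -> (exists x, U x) -> exists x, U x /\ ~ S x.

Definition closure_RN (S : RN -> Prop) : RN -> Prop :=
  fun x => forall U, open_RN U -> U x -> exists y, U y /\ S y.

Definition nowhere_dense (S : RN -> Prop) : Prop :=
  interior_empty (closure_RN S).

Definition meager (M : RN -> Prop) : Prop :=
  exists F : nat -> RN -> Prop, (forall k, nowhere_dense (F k)) /\
    forall x, M x -> exists k, F k x.

Definition comeager (C : RN -> Prop) : Prop := meager (fun x => ~ C x).

Definition baire_property (B : RN -> Prop) : Prop :=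
  exists U, open_RN U /\ meager (fun x => ~ (B x <-> U x)).

Inductive borel_RN : (RN -> Prop) -> Prop :=
  | borel_open : forall U, open_RN U -> borel_RN U
  | borel_compl : forall B, borel_RN B -> borel_RN (fun x => ~ B x)
  | borel_cunion : forall Bs : nat -> RN -> Prop,
      (forall k, borel_RN (Bs k)) -> borel_RN (fun x => exists k, Bs k x).

(** Injective sequences Inj(N,R) (a G_delta, hence Polish, subspace of R^N). *)
Definition injective_seq (y : RN) : Prop := forall a b, y a = y b -> a = b.

(** Maps R^N -> Inj(N,R) are represented as maps f : RN -> RN with
    values in Inj(N,R); open sets of Inj(N,R) are traces of open sets of R^N. *)
Definition maps_into_inj (f : RN -> RN) : Prop := forall x, injective_seq (f x).

Definition baire_measurable_to_inj (f : RN -> RN) : Prop :=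
  maps_into_inj f /\ forall V, open_RN V -> baire_property (fun x => V (f x)).

Definition borel_to_inj (f : RN -> RN) : Prop :=
  maps_into_inj f /\ forall V, open_RN V -> borel_RN (fun x => V (f x)).

(** (g x)(a) = x (g^{-1} a), i.e. (g x)(g b) = x b. *)
Definition shift_rel (g : nat -> nat) (x y : RN) : Prop :=
  forall b, y (g b) = x b.

Definition E_bern (P : (nat -> nat) -> Prop) (x y : RN) : Prop :=
  exists g, P g /\ shift_rel g x y.

Definition E_inj (Q : (nat -> nat) -> Prop) (x y : RN) : Prop :=
  injective_seq x /\ injective_seq y /\ E_bern Q x y.

Definition generically_ergodic_inj (P Q : (nat -> nat) -> Prop) : Prop :=
  forall f : RN -> RN, baire_measurable_to_inj f ->
    (forall x x', E_bern P x x' -> E_inj Q (f x) (f x')) ->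
    exists (C : RN -> Prop) (y0 : RN), comeager C /\ injective_seq y0 /\
      forall x, C x -> E_inj Q (f x) y0.

Definition borel_reducible_inj (P Q : (nat -> nat) -> Prop) : Prop :=
  exists f : RN -> RN, borel_to_inj f /\
    forall x x', E_bern P x x' <-> E_inj Q (f x) (f x').

(* Main.v *)
Require Import Defs.
From Stdlib Require Import Reals List Arith Lia Lra Classical ClassicalEpsilon.
From Stdlib Require Import IndefiniteDescription FunctionalExtensionality Cantor.
Open Scope R_scope.

(** Write [x o g] for the right action of [P]; the class of [x] is the set of the [x o g], and [f (x o g)]
    is [f x] composed with an element of [Q]. Let [f] be continuous on the comeager set [C].
    Baire category in [R^N x P] shows that, locally on [C], each real [f x b] depends only on the
    restriction of [x] to a finite algebraically closed set [A]. Freeness gives [n+1] translates of [A],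
    each disjoint from the closure of the others. The corresponding [n+1] reals all occur in
    [f x], so one of them, being algebraic over the others in [Q], takes finitely many values once the
    coordinates in the other translates are fixed. As it depends on the remaining coordinates only, it is
    locally constant. Hence so is every [f x b], and since generic [P]-orbits are dense, the images of two
    generic points are related by elements of [Q] on arbitrarily long initial segments, thus by an element
    of the closed group [Q]. *)

(** * Baire category *)

Lemma bounded_image (g : nat -> nat) (k : nat) :
  exists K, forall i, (i < k)%nat -> (g i < K)%nat.
Proof.
  induction k as [|k [K HK]].
  - exists 0%nat. lia.
  - exists (S (K + g k)). intros i Hi.
    destruct (Nat.eq_dec i k) as [->|Hne]; [lia|].
    specialize (HK i ltac:(lia)). lia.
Qed.

Lemma finite_bounded (l : list nat) : exists K, forall i, In i l -> (i < K)%nat.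
Proof.
  induction l as [|a l [K HK]].
  - exists 0%nat. intros i [].
  - exists (S (K + a)). intros i [->|Hi]; [lia|]. specialize (HK i Hi). lia.
Qed.

(** [near] and [agree] describe the basic neighbourhoods in the two factors of R^N x P. *)
Definition near (k : nat) (e : R) (x y : RN) : Prop :=
  forall i, (i < k)%nat -> Rabs (y i - x i) < e.

Definition agree (k : nat) (g h : nat -> nat) : Prop :=
  forall i, (i < k)%nat -> h i = g i.

Lemma near_refl k e x : 0 < e -> near k e x x.
Proof.
  intros He i _. replace (x i - x i) with 0 by ring. now rewrite Rabs_R0.
Qed.

Lemma near_sym k e x y : near k e x y -> near k e y x.
Proof. intros H i Hi. rewrite Rabs_minus_sym. now apply H. Qed.

Lemma near_weaken k k' e e' x y :
  (k <= k')%nat -> e' <= e -> near k' e' x y -> near k e x y.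
Proof.
  intros Hk He H i Hi. specialize (H i ltac:(lia)). lra.
Qed.

Lemma near_trans k e1 e2 x y z :
  near k e1 x y -> near k e2 y z -> near k (e1 + e2) x z.
Proof.
  intros H1 H2 i Hi. specialize (H1 i Hi). specialize (H2 i Hi).
  replace (z i - x i) with ((y i - x i) + (z i - y i)) by ring.
  eapply Rle_lt_trans; [apply Rabs_triang|lra].
Qed.

(** Finitely many strict inequalities have a common slack. *)
Lemma near_gap k e x y : 0 < e -> near k e x y ->
  exists d, 0 < d /\ forall i, (i < k)%nat -> Rabs (y i - x i) + d < e.
Proof.
  intros He. induction k as [|k IH]; intros H.
  - exists e. split; [easy|]. intros i Hi. lia.
  - destruct IH as [d [Hd HIH]].
    { intros i Hi. apply H. lia. }
    assert (Hk : Rabs (y k - x k) < e) by (apply H; lia).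
    exists (Rmin d ((e - Rabs (y k - x k)) / 2)). split.
    + apply Rmin_pos; lra.
    + intros i Hi. pose proof (Rmin_l d ((e - Rabs (y k - x k)) / 2)).
      pose proof (Rmin_r d ((e - Rabs (y k - x k)) / 2)).
      destruct (Nat.eq_dec i k) as [->|Hne]; [lra|].
      specialize (HIH i ltac:(lia)). lra.
Qed.

Lemma near_open k e x : open_RN (near k e x).
Proof.
  intros y Hy. destruct (Rlt_le_dec 0 e) as [He|He].
  - destruct (near_gap k e x y He Hy) as [d [Hd H]].
    exists k, d. split; [easy|]. intros z Hz i Hi.
    specialize (H i Hi). specialize (Hz i Hi).
    replace (z i - x i) with ((y i - x i) + (z i - y i)) by ring.
    eapply Rle_lt_trans; [apply Rabs_triang|lra].
  - exists 1%nat, 1. split; [lra|]. intros z _ i Hi. exfalso.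
    specialize (Hy i Hi). pose proof (Rabs_pos (y i - x i)). lra.
Qed.

Lemma open_inter U V : open_RN U -> open_RN V -> open_RN (fun x => U x /\ V x).
Proof.
  intros HU HV x [Hx Hx'].
  destruct (HU x Hx) as [k [e [He H]]]. destruct (HV x Hx') as [k' [e' [He' H']]].
  exists (max k k'), (Rmin e e'). split; [now apply Rmin_pos|].
  intros y Hy. split.
  - apply H. apply (near_weaken k (max k k') e (Rmin e e')); auto.
    + lia.
    + apply Rmin_l.
  - apply H'. apply (near_weaken k' (max k k') e' (Rmin e e')); auto.
    + lia.
    + apply Rmin_r.
Qed.

Lemma open_comp (g : nat -> nat) U :
  open_RN U -> open_RN (fun x : RN => U (fun i => x (g i))).
Proof.
  intros HU x Hx. destruct (HU _ Hx) as [k [e [He H]]].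
  destruct (bounded_image g k) as [K HK].
  exists K, e. split; [easy|]. intros y Hy. apply H. intros i Hi.
  apply Hy. now apply HK.
Qed.

Definition dense_RN (D : RN -> Prop) : Prop :=
  forall U, open_RN U -> (exists x, U x) -> exists x, U x /\ D x.

(** Take the complements of the closures of the nowhere dense sets. *)
Lemma comeager_dense_open C :
  comeager C ->
  exists D : nat -> RN -> Prop,
    (forall n, open_RN (D n) /\ dense_RN (D n)) /\
    forall x, (forall n, D n x) -> C x.
Proof.
  intros [F [HF HM]].
  exists (fun n x => ~ closure_RN (F n) x). split.
  - intros n. split.
    + intros x Hx. apply not_all_ex_not in Hx. destruct Hx as [U HU].
      apply imply_to_and in HU. destruct HU as [oU HU].
      apply imply_to_and in HU. destruct HU as [Ux HU].
      destruct (oU x Ux) as [k [e [He H]]]. exists k, e. split; [easy|].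
      intros y Hy Hc. apply HU, Hc; auto.
    + intros U oU HU. exact (HF n U oU HU).
  - intros x Hx. apply NNPP. intros Hn. destruct (HM x Hn) as [k Hk].
    apply (Hx k). intros U oU Ux. now exists x.
Qed.

Lemma dense_open_comeager (D : nat -> RN -> Prop) :
  (forall n, open_RN (D n) /\ dense_RN (D n)) ->
  comeager (fun x => forall n, D n x).
Proof.
  intros HD. exists (fun n x => ~ D n x). split.
  - intros k U oU HU. destruct (HD k) as [Ho Hd].
    destruct (Hd U oU HU) as [x [Ux Dx]]. exists x. split; [easy|].
    intros Hc. destruct (Hc (D k) Ho Dx) as [y [Hy Hy']]. easy.
  - intros x Hx. apply not_all_ex_not in Hx. exact Hx.
Qed.

Lemma comeager_mono (C C' : RN -> Prop) :
  (forall x, C x -> C' x) -> comeager C -> comeager C'.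
Proof.
  intros H [F [HF HM]]. exists F. split; [easy|].
  intros x Hx. apply HM. intros Hc. now apply Hx, H.
Qed.

Lemma comeager_forall (C : nat -> RN -> Prop) :
  (forall n, comeager (C n)) -> comeager (fun x => forall n, C n x).
Proof.
  intros H.
  destruct (functional_choice _ (fun n => comeager_dense_open _ (H n))) as [D HD].
  apply (comeager_mono
    (fun x => forall m, D (fst (of_nat m)) (snd (of_nat m)) x)).
  - intros x Hx n. apply (proj2 (HD n)). intros k.
    specialize (Hx (to_nat (n, k))). now rewrite cancel_of_to in Hx.
  - apply dense_open_comeager. intros m. apply (proj1 (HD _)).
Qed.

Lemma dense_open_comeager1 D : open_RN D -> dense_RN D -> comeager D.
Proof.
  intros Ho Hd. apply (comeager_mono (fun x => forall n : nat, D x)).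
  - intros x H. exact (H 0%nat).
  - now apply dense_open_comeager.
Qed.

Lemma comeager_and C C' :
  comeager C -> comeager C' -> comeager (fun x => C x /\ C' x).
Proof.
  intros H H'.
  apply (comeager_mono
    (fun x => forall n, (match n with O => C | _ => C' end) x)).
  - intros x Hx. split; [exact (Hx 0%nat)|exact (Hx 1%nat)].
  - apply comeager_forall. now intros [|n].
Qed.

Lemma dense_comp g D :
  is_perm g -> dense_RN D -> dense_RN (fun x => D (fun i => x (g i))).
Proof.
  intros [h Hh] HD U oU [x Ux].
  destruct (HD (fun y => U (fun i => y (h i)))) as [y [Uy Dy]].
  - now apply open_comp.
  - exists (fun i => x (g i)).
    replace (fun i => x (g (h i))) with x; [easy|].
    apply functional_extensionality. intros i. now rewrite (proj2 (Hh i)).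
  - exists (fun i => y (h i)). split; [easy|].
    replace (fun i => y (h (g i))) with y; [easy|].
    apply functional_extensionality. intros i. now rewrite (proj1 (Hh i)).
Qed.

Lemma comeager_comp g C :
  is_perm g -> comeager C -> comeager (fun x => C (fun i => x (g i))).
Proof.
  intros Hg HC. destruct (comeager_dense_open _ HC) as [D [HD H]].
  apply (comeager_mono (fun x => forall n, D n (fun i => x (g i)))).
  - intros x Hx. now apply H.
  - apply (dense_open_comeager (fun n x => D n (fun i => x (g i)))).
    intros n. destruct (HD n) as [Ho Hd]. split.
    + now apply open_comp.
    + now apply dense_comp.
Qed.

(** * The Baire category theorem for R^N x P *)

Lemma bij_is_perm (g : nat -> nat) :
  (forall i j, g i = g j -> i = j) -> (forall i, exists j, g j = i) -> is_perm g.
Proof.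
  intros Hi Hs. destruct (functional_choice _ Hs) as [h Hh].
  exists h. intros x. split; [apply Hi; apply Hh|apply Hh].
Qed.

Lemma perm_inj g i j : is_perm g -> g i = g j -> i = j.
Proof. intros [h H] E. rewrite <- (proj1 (H i)), E. apply H. Qed.

(** A stage of the fusion: the current centre, permutation, number of protected coordinates and radius. *)
Record stage := Stage { st_x : RN; st_g : nat -> nat; st_k : nat; st_e : R }.

Definition stage_le (s t : stage) : Prop :=
  (st_k s <= st_k t)%nat /\ agree (st_k s) (st_g s) (st_g t) /\
  forall i, (i < st_k s)%nat -> Rabs (st_x t i - st_x s i) + st_e t <= st_e s.

Lemma stage_le_trans s t u : stage_le s t -> stage_le t u -> stage_le s u.
Proof.
  intros [H1 [H2 H3]] [H4 [H5 H6]]. split; [lia|]. split.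
  - intros i Hi. rewrite H5 by lia. now apply H2.
  - intros i Hi. specialize (H3 i Hi). specialize (H6 i ltac:(lia)).
    replace (st_x u i - st_x s i)
      with ((st_x t i - st_x s i) + (st_x u i - st_x t i)) by ring.
    pose proof (Rabs_triang (st_x t i - st_x s i) (st_x u i - st_x t i)). lra.
Qed.

(** The inverses have to be controlled as well, since a pointwise limit of permutations need not be surjective. *)
Lemma stage_limit (P : (nat -> nat) -> Prop) (s : nat -> stage) :
  polish_perm_group P ->
  (forall n, P (st_g (s n)) /\ 0 < st_e (s n)) ->
  (forall n, stage_le (s n) (s (S n))) ->
  (forall n, (n < st_k (s (S n)))%nat) ->
  (forall n i, (i < n)%nat ->
     exists j, (j < st_k (s (S n)))%nat /\ st_g (s (S n)) j = i) ->
  exists y h, P h /\ forall n, agree (st_k (s n)) (st_g (s n)) h /\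
    forall i, (i < st_k (s n))%nat -> Rabs (y i - st_x (s n) i) <= st_e (s n).
Proof.
  intros HP Hok Hle Hk Hsurj.
  assert (Hmon : forall n m, (n <= m)%nat -> stage_le (s n) (s m)).
  { intros n m Hnm. induction Hnm as [|m Hnm IH].
    - split; [lia|]. split; [easy|]. intros i _.
      replace (st_x (s n) i - st_x (s n) i) with 0 by ring.
      rewrite Rabs_R0. lra.
    - eapply stage_le_trans; [exact IH|apply Hle]. }
  (* Coordinate [i] is protected from stage [S i] on, so its image is read off there. *)
  set (h := fun i => st_g (s (S i)) i).
  assert (Hh : forall n, agree (st_k (s n)) (st_g (s n)) h).
  { intros n i Hi. unfold h.
    destruct (Hmon n (max n (S i)) ltac:(lia)) as [_ [H1 _]].
    destruct (Hmon (S i) (max n (S i)) ltac:(lia)) as [_ [H2 _]].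
    rewrite <- (H1 i Hi). symmetry. apply H2. apply Hk. }
  assert (Hlim : forall i, exists y : R, forall n, (i < st_k (s n))%nat ->
            Rabs (y - st_x (s n) i) <= st_e (s n)).
  { intros i.
    assert (Hcmp : forall n m, (i < st_k (s n))%nat -> (i < st_k (s m))%nat ->
      st_x (s n) i - st_e (s n) <= st_x (s m) i + st_e (s m)).
    { intros n m Hn Hm. set (M := max n m).
      destruct (Hmon n M ltac:(lia)) as [_ [_ H1]].
      destruct (Hmon m M ltac:(lia)) as [_ [_ H2]].
      specialize (H1 i Hn). specialize (H2 i Hm).
      destruct (Hok M) as [_ HM].
      pose proof (Rle_abs (st_x (s M) i - st_x (s m) i)).
      pose proof (Rle_abs (- (st_x (s M) i - st_x (s n) i))).
      rewrite Rabs_Ropp in *. lra. }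
    (* The intervals around the centres are nested; the supremum of their left end points lies in
       all of them. *)
    destruct (completeness
      (fun r => exists n, (i < st_k (s n))%nat /\ r = st_x (s n) i - st_e (s n)))
      as [L [HL1 HL2]].
    - exists (st_x (s (S i)) i + st_e (s (S i))).
      intros r [n [Hn ->]]. apply Hcmp; auto.
    - exists (st_x (s (S i)) i - st_e (s (S i))). exists (S i). auto.
    - exists L. intros n Hn.
      assert (st_x (s n) i - st_e (s n) <= L) by (apply HL1; eauto).
      assert (L <= st_x (s n) i + st_e (s n)).
      { apply HL2. intros r [m [Hm ->]]. apply Hcmp; auto. }
      apply Rabs_le. lra. }
  destruct (functional_choice _ Hlim) as [y Hy].
  exists y, h. split.
  - apply (ppg_closed P HP).
    + apply bij_is_perm.
      * intros i j E. set (M := S (max i j)).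
        assert (HM : (M <= st_k (s (S M)))%nat) by (pose proof (Hk M); lia).
        rewrite (Hh (S M) i ltac:(lia)), (Hh (S M) j ltac:(lia)) in E.
        eapply perm_inj; [|exact E]. apply (ppg_perm P HP), Hok.
      * intros i. destruct (Hsurj (S i) i ltac:(lia)) as [j [Hj E]].
        exists j. rewrite (Hh _ j Hj). exact E.
    + intros n. exists (st_g (s (S n))). split; [apply Hok|].
      intros i Hi. symmetry. apply Hh. pose proof (Hk n). lia.
  - intros n. split; [apply Hh|]. intros i Hi. now apply Hy.
Qed.

(** The sets [D n] are open and dense relative to [P]; the common point is the limit of a fusion
    sequence that enters [D n] at step [n]. *)
Lemma pair_baire (P : (nat -> nat) -> Prop)
  (D : nat -> RN -> (nat -> nat) -> Prop) :
  polish_perm_group P ->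
  (forall n x g, D n x g -> exists k e, 0 < e /\
     forall y h, P h -> near k e x y -> agree k g h -> D n y h) ->
  (forall n x g k e, P g -> 0 < e -> exists y h,
     P h /\ near k e x y /\ agree k g h /\ D n y h) ->
  forall x g k e, P g -> 0 < e -> exists y h,
    P h /\ near k e x y /\ agree k g h /\ forall n, D n y h.
Proof.
  intros HP Hopen Hdense x g k e Pg He.
  assert (step : forall ns : nat * stage, exists t,
    P (st_g (snd ns)) -> 0 < st_e (snd ns) ->
    P (st_g t) /\ 0 < st_e t /\ stage_le (snd ns) t /\ (fst ns < st_k t)%nat /\
    (forall i, (i < fst ns)%nat -> exists j, (j < st_k t)%nat /\ st_g t j = i) /\
    (forall y h, P h -> near (st_k t) (2 * st_e t) (st_x t) y ->
       agree (st_k t) (st_g t) h -> D (fst ns) y h) /\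
    (forall y i, (i < st_k (snd ns))%nat ->
       Rabs (y i - st_x t i) <= st_e t -> Rabs (y i - st_x (snd ns) i) < st_e (snd ns))).
  { intros [n [x0 g0 k0 e0]]. simpl.
    destruct (classic (P g0 /\ 0 < e0)) as [[Pg0 He0]|Hn].
    2:{ exists (Stage x0 g0 k0 e0). tauto. }
    destruct (Hdense n x0 g0 k0 e0 Pg0 He0) as [y [h [Ph [Hy [Hh HD]]]]].
    destruct (Hopen n y h HD) as [k1 [e1 [He1 H1]]].
    destruct (near_gap _ _ _ _ He0 Hy) as [d [Hd Hgap]].
    destruct (ppg_perm P HP h Ph) as [h' Hh'].
    destruct (bounded_image h' n) as [K HK].
    (* [k1] and [e1] secure [D n], [K] puts the preimages of all values below [n] among the
       protected coordinates, and [d] keeps the new box inside the old one. The radius is halved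
       because the limit is controlled only by [<=]. *)
    exists (Stage y h (max (max k0 k1) (S (max n K))) (Rmin (e1 / 2) d)).
    pose proof (Rmin_l (e1 / 2) d). pose proof (Rmin_r (e1 / 2) d).
    simpl. intros _ _. split; [easy|]. split; [apply Rmin_pos; lra|].
    split; [|split; [lia|split; [|split]]].
    - split; simpl; [lia|]. split; [easy|].
      intros i Hi. specialize (Hgap i Hi). lra.
    - intros i Hi. exists (h' i). split; [|apply Hh'].
      specialize (HK i Hi). lia.
    - intros z f Pf Hz Hf. apply H1; [easy| |].
      + eapply near_weaken; [| |exact Hz]; [lia|lra].
      + intros i Hi. apply Hf. lia.
    - intros z i Hi Hz. specialize (Hgap i Hi).
      replace (z i - x0 i) with ((y i - x0 i) + (z i - y i)) by ring.
      eapply Rle_lt_trans; [apply Rabs_triang|lra]. }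
  destruct (functional_choice _ step) as [F HF].
  set (s := fix s n := match n with
                       | O => Stage x g k e
                       | S m => F (m, s m) end).
  assert (Hok : forall n, P (st_g (s n)) /\ 0 < st_e (s n)).
  { induction n as [|n [IH1 IH2]]; [easy|].
    destruct (HF (n, s n) IH1 IH2) as [H1 [H2 _]]. easy. }
  assert (Hs := fun n => HF (n, s n) (proj1 (Hok n)) (proj2 (Hok n))).
  simpl in Hs.
  destruct (stage_limit P s HP Hok) as [y [h [Ph Hlim]]].
  - intros n. apply Hs.
  - intros n. apply Hs.
  - intros n. apply Hs.
  - exists y, h. split; [easy|]. split; [|split].
    + intros i Hi. destruct (Hs 0%nat) as [_ [_ [_ [_ [_ [_ H]]]]]].
      apply H; [easy|]. apply (Hlim 1%nat).
      destruct (Hs 0%nat) as [_ [_ [[Hk _] _]]]. simpl in Hk |- *. lia.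
    + apply (Hlim 0%nat).
    + intros n. destruct (Hs n) as [_ [He' [_ [_ [_ [H _]]]]]].
      destruct (Hlim (S n)) as [Ha Hy].
      apply H; [easy| |exact Ha]. intros i Hi. specialize (Hy i Hi).
      simpl in Hy. lra.
Qed.

(** Over the trivial group, the category theorem for R^N x P becomes the one for R^N. *)
Lemma trivial_ppg : polish_perm_group (fun g => g = fun x => x).
Proof.
  split.
  - intros g ->. now exists (fun x => x).
  - easy.
  - now intros g h -> ->.
  - intros g ->. now exists (fun x => x).
  - intros g _ H. apply functional_extensionality. intros i.
    destruct (H (S i)) as [h [-> Hh]]. symmetry. apply Hh. lia.
Qed.

Lemma baire_RN C U :
  comeager C -> open_RN U -> (exists x, U x) -> exists x, U x /\ C x.
Proof.
  intros HC oU [x Ux]. destruct (comeager_dense_open _ HC) as [D [HD H]].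
  destruct (oU x Ux) as [k [e [He HU]]].
  assert (HB := pair_baire _ (fun n x _ => D n x) trivial_ppg).
  destruct (fun H1 H2 => HB H1 H2 x (fun i => i) k e eq_refl He)
    as [y [h [_ [Hy [_ HDy]]]]].
  - intros n z g Hz. destruct (proj1 (HD n) z Hz) as [k' [e' [He' H']]].
    exists k', e'. split; [easy|]. intros y _ _ Hy _. now apply H'.
  - intros n z g k' e' -> He'.
    destruct (proj2 (HD n) (near k' e' z)) as [y [Hy Dy]].
    + apply near_open.
    + exists z. now apply near_refl.
    + exists y, (fun i => i). now repeat split.
  - exists y. split; [now apply HU|now apply H].
Qed.

(** * Algebraic closure *)

Lemma classical_filter (l : list nat) (S : nat -> Prop) :
  exists l', (forall a, In a l' <-> In a l /\ S a) /\ (length l' <= length l)%nat /\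
    ((exists a, In a l /\ ~ S a) -> (length l' < length l)%nat).
Proof.
  induction l as [|b l [l' [H1 [H2 H3]]]].
  - exists nil. simpl. split; [tauto|]. split; [lia|]. now intros [a [[] _]].
  - destruct (classic (S b)) as [Sb|Sb].
    + exists (b :: l'). simpl. split; [|split; [lia|]].
      * intros a. rewrite H1. split; [intros [->|]|]; tauto.
      * intros [a [[->|Ha] Sa]]; [easy|]. apply le_n_S, H3. eauto.
    + exists l'. simpl. split; [|split; [lia|lia]].
      intros a. rewrite H1. split; [tauto|]. intros [[->|]]; tauto.
Qed.

Lemma finite_exact S : finite_nat S -> exists l, forall a, S a <-> In a l.
Proof.
  intros [l Hl]. destruct (classical_filter l S) as [l' [H _]].
  exists l'. intros a. rewrite H. specialize (Hl a). tauto.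
Qed.

Lemma finite_subset S S' :
  (forall a, S a -> S' a) -> finite_nat S' -> finite_nat S.
Proof. intros H [l Hl]. exists l. auto. Qed.

Lemma finite_union S S' :
  finite_nat S -> finite_nat S' -> finite_nat (fun a => S a \/ S' a).
Proof.
  intros [l Hl] [l' Hl']. exists (l ++ l'). intros a [Ha|Ha]; apply in_or_app; auto.
Qed.

Lemma finite_single b : finite_nat (fun a => a = b).
Proof. exists (b :: nil). intros a ->. now left. Qed.

Lemma finite_lt k : finite_nat (fun a => (a < k)%nat).
Proof. exists (seq 0 k). intros a Ha. apply in_seq. lia. Qed.

Lemma finite_img g S : finite_nat S -> finite_nat (img g S).
Proof.
  intros [l Hl]. exists (map g l). intros b [a [Ha ->]]. apply in_map. auto.
Qed.

Lemma finite_bigunion (n : nat) (S : nat -> nat -> Prop) :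
  (forall j, finite_nat (S j)) ->
  finite_nat (fun b => exists j, (j < n)%nat /\ S j b).
Proof.
  intros H. induction n as [|n IH].
  - exists nil. intros a [j [Hj _]]. lia.
  - eapply finite_subset; [|exact (finite_union _ _ IH (H n))].
    intros a [j [Hj Ha]]. destruct (Nat.eq_dec j n) as [->|Hne]; [now right|].
    left. exists j. split; [lia|easy].
Qed.

(** Minimality is up to equivalence, [R d d'] meaning that [d'] is below [d]. The head replaces the
    minimal element of the tail only if it is strictly below it. *)
Lemma preorder_minimal (R : nat -> nat -> Prop) (l : list nat) :
  (forall a b c, R a b -> R b c -> R a c) -> l <> nil ->
  exists d, In d l /\ forall d', In d' l -> R d d' -> R d' d.
Proof.
  intros Htr. induction l as [|x l IH]; [easy|]. intros _.
  destruct l as [|y l].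
  - exists x. split; [now left|]. intros d' [<-|[]]. easy.
  - destruct (IH ltac:(discriminate)) as [m [Hm Hmin]].
    destruct (classic (R m x /\ ~ R x m)) as [[H1 H2]|H].
    + exists x. split; [now left|]. intros d' [<-|Hd] Hxd; [easy|].
      exact (Htr _ _ _ (Hmin d' Hd (Htr _ _ _ H1 Hxd)) H1).
    + exists m. split; [now right|]. intros d' [<-|Hd] Hmd; [tauto|auto].
Qed.

Section AlgebraicClosure.
Variable P : (nat -> nat) -> Prop.
Hypothesis HP : polish_perm_group P.

Lemma stab_id A : stab P A (fun x => x).
Proof. split; [apply (ppg_id P HP)|easy]. Qed.

Lemma stab_comp A g h :
  stab P A g -> stab P A h -> stab P A (fun x => g (h x)).
Proof.
  intros [Pg Hg] [Ph Hh]. split; [now apply (ppg_comp P HP)|].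
  intros a Ha. now rewrite Hh, Hg.
Qed.

Lemma stab_inv A g : stab P A g ->
  exists h, stab P A h /\ forall x, h (g x) = x /\ g (h x) = x.
Proof.
  intros [Pg Hg]. destruct (ppg_inv P HP g Pg) as [h [Ph Hh]].
  exists h. split; [|easy]. split; [easy|]. intros a Ha.
  rewrite <- (Hg a Ha) at 1. apply Hh.
Qed.

Lemma stab_mono A A' g :
  (forall a, A a -> A' a) -> stab P A' g -> stab P A g.
Proof. intros H [Pg Hg]. split; auto. Qed.

Lemma acl_incl A a : A a -> acl P A a.
Proof.
  intros Ha. exists (a :: nil). intros b [g [[_ Hg] ->]]. left. symmetry. auto.
Qed.

Lemma acl_mono A A' a : (forall b, A b -> A' b) -> acl P A a -> acl P A' a.
Proof.
  intros H. apply finite_subset. intros b [g [Hg ->]].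
  exists g. split; [|easy]. now apply (stab_mono A A').
Qed.

(** The orbit of [a] over [A] is covered by finitely many translates of the finite orbit of [a] over
    [A] and [b], one for each point of the orbit of [b]. *)
Lemma acl_cut A b a :
  acl P A b -> acl P (fun x => A x \/ x = b) a -> acl P A a.
Proof.
  intros [l Hl] [la Hla].
  destruct (functional_choice
    (fun b' g' => (exists g, stab P A g /\ b' = g b) -> stab P A g' /\ b' = g' b))
    as [G HG].
  { intros b'. destruct (classic (exists g, stab P A g /\ b' = g b)) as [[g H]|H].
    - now exists g.
    - exists (fun x => x). tauto. }
  exists (flat_map (fun b' => map (G b') la) l).
  intros c [g [Hg ->]]. apply in_flat_map. exists (g b). split.
  - apply Hl. now exists g.
  - destruct (HG (g b)) as [H1 H2]; [now exists g|].
    destruct (stab_inv _ _ H1) as [h [Hh Hinv]].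
    replace (g a) with (G (g b) (h (g a))) by apply Hinv.
    apply in_map, Hla. exists (fun x => h (g x)). split; [|easy].
    destruct (stab_comp _ _ _ Hh Hg) as [H3 H4]. split; [easy|].
    intros x [Hx| ->]; [auto|]. rewrite H2. apply Hinv.
Qed.

Lemma acl_cut_list A l a :
  (forall c, In c l -> acl P A c) -> acl P (fun x => A x \/ In x l) a -> acl P A a.
Proof.
  induction l as [|c l IH]; intros Hl Ha.
  - eapply acl_mono; [|exact Ha]. now intros b [Hb|[]].
  - apply IH; [intros; apply Hl; now right|].
    apply (acl_cut _ c).
    + eapply acl_mono; [|apply Hl; now left]. tauto.
    + eapply acl_mono; [|exact Ha]. intros b [Hb|[->|Hb]]; tauto.
Qed.

(** Conjugation by [g] matches the stabilizers of [A] and of [img g A]. *)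
Lemma acl_conj A a g : P g -> acl P A a -> acl P (img g A) (g a).
Proof.
  intros Pg [l Hl]. destruct (ppg_inv P HP g Pg) as [h [Ph Hh]].
  exists (map g l). intros b [f [[Pf Hf] ->]].
  replace (f (g a)) with (g (h (f (g a)))) by apply Hh.
  apply in_map, Hl. exists (fun x => h (f (g x))). split; [|easy]. split.
  - apply (ppg_comp P HP h (fun x => f (g x))); [easy|].
    now apply (ppg_comp P HP f g).
  - intros x Hx. rewrite Hf; [apply Hh|]. now exists x.
Qed.

Hypothesis Hlf : locally_finite P.

(** By local finiteness the closure is a finite list, whose points can be cut one at a time. *)
Lemma acl_idem A a : finite_nat A -> acl P (acl P A) a -> acl P A a.
Proof.
  intros HA Ha. destruct (finite_exact _ (Hlf A HA)) as [l Hl].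
  apply (acl_cut_list A l); [intros; now apply Hl|].
  eapply acl_mono; [|exact Ha]. intros b Hb. right. now apply Hl.
Qed.

(** P. M. Neumann's separation lemma. Local finiteness allows the following shortcut: a point [d] of [D]
    that is minimal for algebraicity over [A] is moved off the closure of [A] and [E]; this takes
    every point of [D] interalgebraic with [d] off [E], and what is left of [D] avoids the closure of [d]. *)
Lemma neumann_separation (D : list nat) (A : nat -> Prop) (E : list nat) :
  finite_nat A -> (forall a, acl P A a -> A a) -> (forall d, In d D -> ~ A d) ->
  exists g, stab P A g /\ forall d, In d D -> ~ In (g d) E.
Proof.
  remember (length D) as N eqn:HN.
  assert (HN' : (length D <= N)%nat) by lia. clear HN.
  revert D A E HN'. induction N as [|N IH]; intros D A E HN HA HclA HD.
  { exists (fun x => x). split; [apply stab_id|].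
    destruct D; [easy|simpl in HN; lia]. }
  destruct (classic (D = nil)) as [->|Hne].
  { exists (fun x => x). split; [apply stab_id|easy]. }
  destruct (preorder_minimal (fun d d' => acl P (fun x => A x \/ x = d) d') D)
    as [d [Hd Hmin]]; [|easy|].
  { intros a b c Hab Hbc. apply (acl_cut _ b); [exact Hab|].
    eapply acl_mono; [|exact Hbc]. intros x [Hx| ->]; tauto. }
  set (AE := acl P (fun x => A x \/ In x E)).
  assert (HAE : finite_nat AE).
  { apply Hlf, finite_union; [easy|]. now exists E. }
  (* If every such [g d] lay in the finite set [AE], then [d] would be algebraic over [A]. *)
  assert (exists g, stab P A g /\ ~ AE (g d)) as [g [Hg Hgd]].
  { apply NNPP. intros Hn. apply (HD d Hd), HclA.
    eapply finite_subset; [|exact HAE]. intros b [g [Hg ->]].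
    apply NNPP. intros Hb. apply Hn. now exists g. }
  destruct (stab_inv _ _ Hg) as [h [Hh Hinv]].
  set (B := acl P (fun x => A x \/ x = d)).
  assert (HAd : finite_nat (fun x => A x \/ x = d)).
  { apply finite_union; [easy|apply finite_single]. }
  destruct (classical_filter D (fun x => ~ B x)) as [D' [HD'1 [_ HD'2]]].
  (* [D'] is moved over [B] off the preimage of [E] under [g], so that applying [g] afterwards takes
     it off [E]. *)
  destruct (IH D' B (map h E)) as [f [Hf HfD]].
  - enough (length D' < length D)%nat by lia. apply HD'2. exists d.
    split; [easy|]. intros Hn. apply Hn, acl_incl. now right.
  - now apply Hlf.
  - intros a. now apply acl_idem.
  - intros x Hx. now apply HD'1.
  - exists (fun x => g (f x)). split.
    + apply stab_comp; [easy|]. eapply stab_mono; [|exact Hf].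
      intros a Ha. apply acl_incl. now left.
    + intros x Hx Hin. destruct (classic (B x)) as [HB|HB].
      * rewrite (proj2 Hf x HB) in Hin. apply Hgd. unfold AE.
        (* By minimality [d] is algebraic over [A] and [x], so [g d] is algebraic over [A] and
           [g x]; with [g x] in [E] this contradicts the choice of [g]. *)
        assert (Hxd := acl_conj _ _ _ (proj1 Hg) (Hmin x Hx HB)).
        eapply acl_mono; [|exact Hxd].
        intros b [a [[Ha| ->] ->]]; [|now right].
        left. now rewrite (proj2 Hg a Ha).
      * apply (HfD x); [now apply HD'1|].
        rewrite <- (proj1 (Hinv (f x))). now apply in_map.
Qed.

(** Each open condition can be secured by finitely many coordinates. Separation over [A] moves those
    of the second that lie outside [A] away from those of the first, and on [A] the two requirements
    agree. *)
Lemma amalgamation (A : nat -> Prop) (U1 U2 : RN -> Prop) (z1 z2 : RN) :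
  finite_nat A -> (forall a, acl P A a -> A a) ->
  open_RN U1 -> open_RN U2 -> U1 z1 -> U2 z2 -> (forall a, A a -> z1 a = z2 a) ->
  exists g x, stab P A g /\ U1 x /\ U2 (fun i => x (g i)).
Proof.
  intros HA HclA o1 o2 H1 H2 Hz.
  destruct (o1 z1 H1) as [k1 [e1 [He1 HU1]]].
  destruct (o2 z2 H2) as [k2 [e2 [He2 HU2]]].
  destruct (classical_filter (seq 0 k2) (fun x => ~ A x)) as [D [HD _]].
  destruct (neumann_separation D A (seq 0 k1) HA HclA) as [g [Hg HgD]].
  { intros d Hd. now apply HD. }
  destruct (ppg_perm P HP g (proj1 Hg)) as [h Hh].
  exists g, (fun j => if lt_dec j k1 then z1 j else z2 (h j)).
  split; [easy|]. split.
  - apply HU1. intros i Hi. destruct (lt_dec i k1); [|lia].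
    now apply near_refl with (k := k1).
  - apply HU2. intros i Hi.
    assert (E : (if lt_dec (g i) k1 then z1 (g i) else z2 (h (g i))) = z2 i).
    { destruct (lt_dec (g i) k1) as [Hl|Hl].
      - destruct (classic (A i)) as [Ai|Ai].
        + rewrite (proj2 Hg i Ai). auto.
        + exfalso. apply (HgD i); [|apply in_seq; lia].
          apply HD. split; [apply in_seq; lia|easy].
      - now rewrite (proj1 (Hh i)). }
    rewrite E. now apply near_refl with (k := k2).
Qed.

End AlgebraicClosure.

(** * Finite supports *)

Lemma open_near_comp U x g : open_RN U -> U (fun i => x (g i)) ->
  exists k e, 0 < e /\ forall y h, near k e x y -> agree k g h ->
    U (fun i => y (h i)).
Proof.
  intros oU Ux. destruct (oU _ Ux) as [k [e [He H]]].
  destruct (bounded_image g k) as [K HK].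
  exists (max k K), e. split; [easy|]. intros y h Hy Hh. apply H.
  intros i Hi. rewrite (Hh i ltac:(lia)). apply Hy.
  specialize (HK i Hi). lia.
Qed.

Lemma comp_inv_l (x : RN) (g h : nat -> nat) :
  (forall i, h (g i) = i /\ g (h i) = i) -> (fun i => x (h (g i))) = x.
Proof.
  intros H. apply functional_extensionality. intros i. now rewrite (proj1 (H i)).
Qed.

Definition continuous_on (C : RN -> Prop) (f : RN -> RN) : Prop :=
  forall b x, C x -> forall eps, 0 < eps -> exists k e, 0 < e /\
    forall y, C y -> near k e x y -> Rabs (f y b - f x b) < eps.

(** Continuity on [U] and [C] in terms of the coordinates in [A] alone; in particular the value at such
    points depends only on the restriction to [A]. *)
Definition supported (C : RN -> Prop) (f : RN -> RN) (b : nat) (A : nat -> Prop)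
  (U : RN -> Prop) : Prop :=
  forall u, U u -> C u -> forall eps, 0 < eps -> exists d, 0 < d /\
    forall y, U y -> C y -> (forall a, A a -> Rabs (y a - u a) < d) ->
      Rabs (f y b - f u b) < eps.

Lemma supported_eq C f b A U u y :
  supported C f b A U -> U u -> C u -> U y -> C y ->
  (forall a, A a -> y a = u a) -> f y b = f u b.
Proof.
  intros HS Uu Cu Uy Cy Hyu. apply cond_eq. intros eps He.
  destruct (HS u Uu Cu eps He) as [d [Hd H]]. apply H; auto.
  intros a Ha. rewrite (Hyu a Ha). now replace (u a - u a) with 0 by ring; rewrite Rabs_R0.
Qed.

Section Homomorphism.
Variables P Q : (nat -> nat) -> Prop.
Hypothesis HP : polish_perm_group P.
Hypothesis HQ : polish_perm_group Q.
Hypothesis Hlf : locally_finite P.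
Variable f : RN -> RN.
Hypothesis Hhom : forall x x', E_bern P x x' -> E_inj Q (f x) (f x').
Variable C : RN -> Prop.
Hypothesis HC : comeager C.
Hypothesis Hcont : continuous_on C f.

Lemma hom_comp x g : P g ->
  exists q, Q q /\ forall b, f x (q b) = f (fun i => x (g i)) b.
Proof.
  intros Pg. destruct (Hhom (fun i => x (g i)) x) as [_ [_ [q [Qq Hq]]]].
  - now exists g.
  - now exists q.
Qed.

(** Demanding the inequality on a whole neighbourhood makes this an open condition on the pair
    [(x, g)]. *)
Definition avoids (U0 : RN -> Prop) (b a : nat) (x : RN) (g : nat -> nat) : Prop :=
  exists k e, 0 < e /\ forall y h, P h -> near k e x y -> agree k g h ->
    C y -> C (fun i => y (h i)) -> U0 (fun i => y (h i)) ->
    f (fun i => y (h i)) b <> f y a.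

Lemma avoids_open U0 b a x g : avoids U0 b a x g ->
  exists k e, 0 < e /\ forall y h, P h -> near k e x y -> agree k g h ->
    avoids U0 b a y h.
Proof.
  intros [k [e [He H]]]. exists k, (e / 2). split; [lra|].
  intros y h Ph Hy Hh. exists k, (e / 2). split; [lra|].
  intros z h' Ph' Hz Hh'. apply H; [easy| |].
  - replace e with (e / 2 + e / 2) by field. now apply (near_trans k _ _ x y z).
  - intros i Hi. rewrite Hh' by easy. now apply Hh.
Qed.

(** If [avoids] fails, some pair [(y, h)] arbitrarily near [(v, g)] has [f (y o h) b = f y a]; the
    left side is close to [r] by the bound on [W], the right side to [f v a] by continuity. *)
Lemma not_avoids_close U0 b a v g W r eps1 eps2 :
  open_RN W -> (forall z, W z -> C z -> Rabs (f z b - r) < eps1) -> 0 < eps2 ->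
  P g -> C v -> W (fun i => v (g i)) -> ~ avoids U0 b a v g ->
  Rabs (f v a - r) < eps1 + eps2.
Proof.
  intros oW HW He2 Pg Cv Wv Hna.
  destruct (open_near_comp W v g oW Wv) as [k1 [e1 [He1 H1]]].
  destruct (Hcont a v Cv eps2 He2) as [k2 [e2 [He2' H2]]].
  apply NNPP. intros Hlt. apply Hna.
  exists (max k1 k2), (Rmin e1 e2). split; [now apply Rmin_pos|].
  intros y h Ph Hy Hh Cy Cyh _ E. apply Hlt.
  assert (Hw : Rabs (f (fun i => y (h i)) b - r) < eps1).
  { apply HW; [|easy]. apply H1.
    - eapply near_weaken; [| |exact Hy]; [lia|apply Rmin_l].
    - intros i Hi. apply Hh. lia. }
  assert (Hc : Rabs (f y a - f v a) < eps2).
  { apply H2; [easy|]. eapply near_weaken; [| |exact Hy]; [lia|apply Rmin_r]. }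
  rewrite E in Hw. rewrite Rabs_minus_sym in Hc.
  replace (f v a - r) with ((f v a - f y a) + (f y a - r)) by ring.
  eapply Rle_lt_trans; [apply Rabs_triang|lra].
Qed.

(** Failure of support gives [u] and [y] in [U], close on the closure [A] of the first [k]
    coordinates, with [f u b] and [f y b] at least [eps] apart. Amalgamation over [A] yields [v],
    and [gam] fixing [A], with [v o g] near [u] and [v o g o gam] near [y]. The single real [f v a]
    cannot be within [eps / 2] of both values, so [avoids] holds at [(v, g)] or at
    [(v, g o gam)]. *)
Lemma avoids_extend (U0 U : RN -> Prop) b a x g k e :
  0 < e -> P g -> open_RN U -> (exists z, U z) ->
  (forall z, U z -> exists y, near k e x y /\ z = fun i => y (g i)) ->
  ~ supported C f b (acl P (fun i => (i < k)%nat)) U ->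
  exists y h, P h /\ near k e x y /\ agree k g h /\ avoids U0 b a y h.
Proof.
  intros He Pg oU HU HUnear Hns.
  apply not_all_ex_not in Hns. destruct Hns as [u Hns].
  apply imply_to_and in Hns. destruct Hns as [Uu Hns].
  apply imply_to_and in Hns. destruct Hns as [Cu Hns].
  apply not_all_ex_not in Hns. destruct Hns as [eps Hns].
  apply imply_to_and in Hns. destruct Hns as [Heps Hns].
  set (A := acl P (fun i => (i < k)%nat)) in *.
  destruct (oU u Uu) as [k1 [e1 [He1 HU1]]].
  destruct (Hcont b u Cu (eps / 3) ltac:(lra)) as [k2 [e2 [He2 HU2]]].
  set (k0 := max k1 k2). set (e0 := Rmin e1 e2).
  assert (He0 : 0 < e0) by now apply Rmin_pos.
  assert (exists y, U y /\ C y /\ (forall c, A c -> Rabs (y c - u c) < e0) /\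
                    eps <= Rabs (f y b - f u b)) as [y [Uy [Cy [HyA Hy]]]].
  { apply NNPP. intros Hn. apply Hns. exists e0. split; [easy|].
    intros y Uy Cy HyA. apply Rnot_le_lt. intros Hle. apply Hn. now exists y. }
  destruct (Hcont b y Cy (eps / 3) ltac:(lra)) as [k3 [e3 [He3 HU3]]].
  set (U1 := near k0 e0 u).
  set (U2 := fun z => U z /\ near k3 e3 y z).
  assert (o1 : open_RN U1) by apply near_open.
  assert (o2 : open_RN U2) by (apply open_inter; [easy|apply near_open]).
  assert (H1U : forall z, U1 z -> U z).
  { intros z Hz. apply HU1.
    apply (near_weaken k1 k0 e1 e0); [unfold k0; lia|apply Rmin_l|exact Hz]. }
  (* The first point is [y] on [A] and [u] elsewhere; it is near [u] because [y] is close to [u] on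
     [A]. *)
  destruct (amalgamation P HP Hlf A U1 U2
    (fun j => if excluded_middle_informative (A j) then y j else u j) y)
    as [gam [w [Hgam [H1w H2w]]]]; auto.
  - apply Hlf, finite_lt.
  - intros c. apply acl_idem; auto. apply finite_lt.
  - intros i Hi. destruct (excluded_middle_informative (A i)) as [Ai|Ai].
    + now apply HyA.
    + now apply (near_refl k0).
  - split; [easy|]. now apply near_refl.
  - intros i Hi. now destruct (excluded_middle_informative (A i)).
  - destruct (HUnear w (H1U w H1w)) as [y0 [Hy0 Ew]].
    assert (Pgg : P (fun i => g (gam i))) by (apply (ppg_comp P HP); [easy|apply Hgam]).
    destruct (baire_RN C (fun v => near k e x v /\
      (U1 (fun i => v (g i)) /\ U2 (fun i => v (g (gam i))))) HC)
      as [v [[Hv [Hv1 Hv2]] Cv]].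
    { apply open_inter; [apply near_open|]. apply open_inter.
      - now apply (open_comp g).
      - now apply (open_comp (fun i => g (gam i))). }
    { exists y0. split; [easy|]. subst w. now split. }
    destruct (classic (avoids U0 b a v g)) as [Ha|Ha].
    { exists v, g. now repeat split. }
    destruct (classic (avoids U0 b a v (fun i => g (gam i)))) as [Ha'|Ha'].
    { exists v, (fun i => g (gam i)). repeat split; auto.
      intros i Hi. rewrite (proj2 Hgam); [easy|]. now apply acl_incl. }
    exfalso.
    assert (D1 : Rabs (f v a - f u b) < eps / 3 + eps / 6).
    { apply (not_avoids_close U0 b a v g U1); auto; [|lra].
      intros z Hz Cz. apply HU2; [easy|].
      apply (near_weaken k2 k0 e2 e0); [unfold k0; lia|apply Rmin_r|exact Hz]. }
    assert (D2 : Rabs (f v a - f y b) < eps / 3 + eps / 6).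
    { apply (not_avoids_close U0 b a v (fun i => g (gam i)) U2); auto; [|lra].
      intros z [_ Hz] Cz. now apply HU3. }
    rewrite Rabs_minus_sym in D2.
    pose proof (Rabs_triang (f y b - f v a) (f v a - f u b)) as T.
    replace (f y b - f v a + (f v a - f u b)) with (f y b - f u b) in T by ring.
    lra.
Qed.

(** If no open set worked, a generic pair [(x, g)] with [x o g] in [U0] would satisfy
    [f (x o g) b <> f x a] for all [a], although [f (x o g)] is a permutation of [f x]. *)
Lemma supported_dense U0 b : open_RN U0 -> (exists x, U0 x) ->
  exists A U, finite_nat A /\ (forall a, acl P A a -> A a) /\ open_RN U /\
    (exists x, U x) /\ (forall x, U x -> U0 x) /\ supported C f b A U.
Proof.
  intros oU0 [x0 Ux0]. apply NNPP. intros Hno.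
  destruct (comeager_dense_open _ HC) as [D [HD HDC]].
  (* Three families in one sequence: tags 0 and 1 put [x] and [x o g] into [C], and larger tags ask
     for [avoids] at index [m]. *)
  set (DD := fun n (x : RN) (g : nat -> nat) =>
    match of_nat n with
    | (O, m) => D m x
    | (S O, m) => D m (fun i => x (g i))
    | (_, m) => avoids U0 b m x g
    end).
  destruct (open_near_comp U0 x0 (fun i => i) oU0 Ux0) as [k0 [e0 [He0 H0]]].
  destruct (pair_baire P DD HP) with (x := x0) (g := fun i : nat => i) (k := k0) (e := e0)
    as [y [h [Ph [Hy [Hh HDy]]]]]; auto.
  - intros n x g. unfold DD. destruct (of_nat n) as [[|[|j]] m]; intros Hx.
    + destruct (proj1 (HD m) x Hx) as [k [e [He H]]].
      exists k, e. split; [easy|]. intros y h _ Hy _. now apply H.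
    + destruct (open_near_comp (D m) x g (proj1 (HD m)) Hx) as [k [e [He H]]].
      exists k, e. split; [easy|]. intros y h _ Hy Hh. now apply H.
    + now apply avoids_open.
  - intros n x g k e Pg He. unfold DD. destruct (of_nat n) as [[|[|j]] m].
    + destruct (proj2 (HD m) (near k e x)) as [y [Hy Dy]].
      * apply near_open.
      * exists x. now apply near_refl.
      * exists y, g. now repeat split.
    + destruct (dense_comp g (D m) (ppg_perm P HP g Pg) (proj2 (HD m)) (near k e x))
        as [y [Hy Dy]].
      * apply near_open.
      * exists x. now apply near_refl.
      * exists y, g. now repeat split.
    (* Either a nearby pair has its translate in [U0], and [avoids_extend] applies to it, or
       [avoids] is vacuous near [(x, g)]. *)
    + destruct (classic (exists x1 g1, P g1 /\ near k e x x1 /\ agree k g g1 /\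
                                       U0 (fun i => x1 (g1 i))))
        as [[x1 [g1 [Pg1 [Hx1 [Hg1 HU]]]]]|Hn].
      * destruct (ppg_inv P HP g1 Pg1) as [h1 [_ Hh1]].
        set (U := fun z : RN => U0 z /\ near k e x (fun i => z (h1 i))).
        assert (oU : open_RN U).
        { apply open_inter; [easy|]. apply (open_comp h1), near_open. }
        assert (HUx1 : U (fun i => x1 (g1 i))).
        { split; [easy|]. replace (fun i => x1 (g1 (h1 i))) with x1; [easy|].
          symmetry. apply comp_inv_l. intros i. split; apply Hh1. }
        destruct (avoids_extend U0 U b m x g1 k e) as [y [h [Ph [Hy [Hh Ha]]]]]; auto.
        -- eauto.
        -- intros z [_ Hz]. exists (fun i => z (h1 i)). split; [easy|].
           symmetry. now apply comp_inv_l.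
        -- intros Hs. apply Hno. exists (acl P (fun i => (i < k)%nat)), U.
           split; [apply Hlf, finite_lt|].
           split; [intros a; apply acl_idem; auto; apply finite_lt|].
           split; [easy|]. split; [eauto|]. split; [now intros z [Hz _]|easy].
        -- exists y, h. repeat split; auto.
           intros i Hi. now rewrite Hh, Hg1.
      * exists x, g. split; [easy|]. split; [now apply near_refl|]. split; [easy|].
        exists k, e. split; [easy|]. intros y h Ph Hy Hh _ _ HU _.
        apply Hn. now exists y, h.
  - apply (ppg_id P HP).
  - assert (Cy : C y).
    { apply HDC. intros m. specialize (HDy (to_nat (0%nat, m))).
      unfold DD in HDy. now rewrite cancel_of_to in HDy. }
    assert (Cyh : C (fun i => y (h i))).
    { apply HDC. intros m. specialize (HDy (to_nat (1%nat, m))).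
      unfold DD in HDy. now rewrite cancel_of_to in HDy. }
    destruct (hom_comp y h Ph) as [q [_ Hq]].
    specialize (HDy (to_nat (2%nat, q b))).
    unfold DD in HDy. rewrite cancel_of_to in HDy.
    destruct HDy as [k [e [He H]]]. apply (H y h); auto.
    + now apply near_refl.
    + now intros i _.
Qed.

(** * Local constancy *)

(** At each point some index [c] works, by [hom_comp]. There are countably many indices, so by Baire
    category one of them works throughout an open set. *)
Lemma transfer_index W g b : open_RN W -> (exists x, W x) -> P g ->
  exists c W', open_RN W' /\ (exists x, W' x) /\ (forall x, W' x -> W x) /\
    forall x, W' x -> C x -> C (fun i => x (g i)) ->
      f x c = f (fun i => x (g i)) b.
Proof.
  intros oW HW Pg. apply NNPP. intros Hno.
  set (good := fun y => C y /\ C (fun i => y (g i))).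
  assert (Hgood : comeager good).
  { apply comeager_and; [easy|]. apply comeager_comp; [|easy]. now apply (ppg_perm P HP). }
  set (D := fun c x => exists k e, 0 < e /\ forall y, near k e x y -> W y -> good y ->
    f y c <> f (fun i => y (g i)) b).
  assert (HD : forall c, comeager (D c)).
  { intros c. apply dense_open_comeager1.
    - intros x [k [e [He H]]]. exists k, (e / 2). split; [lra|].
      intros y Hy. exists k, (e / 2). split; [lra|]. intros z Hz. apply H.
      replace e with (e / 2 + e / 2) by field. now apply (near_trans k _ _ x y z).
    - intros O oO HO.
      (* If [c] fails at a good point of [O] and [W], continuity makes it fail nearby. Otherwise [O]
         and [W] are disjoint by [Hno], and [D c] is vacuous on [O]. *)
      destruct (classic (exists y, O y /\ W y /\ good y /\
                         f y c <> f (fun i => y (g i)) b)) as [[y [Oy [Wy [[Cy Cyg] Hne]]]]|Hn].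
      + exists y. split; [easy|].
        set (d := Rabs (f y c - f (fun i => y (g i)) b)).
        assert (Hd : 0 < d) by (apply Rabs_pos_lt; lra).
        destruct (Hcont c y Cy (d / 2) ltac:(lra)) as [k1 [e1 [He1 H1]]].
        destruct (Hcont b _ Cyg (d / 2) ltac:(lra)) as [k2 [e2 [He2 H2]]].
        destruct (bounded_image g k2) as [K HK].
        exists (max k1 K), (Rmin e1 e2). split; [now apply Rmin_pos|].
        intros z Hz _ [Cz Czg] E.
        assert (E1 : Rabs (f z c - f y c) < d / 2).
        { apply H1; [easy|]. eapply near_weaken; [| |exact Hz]; [lia|apply Rmin_l]. }
        assert (E2 : Rabs (f (fun i => z (g i)) b - f (fun i => y (g i)) b) < d / 2).
        { apply H2; [easy|]. intros i Hi. specialize (HK i Hi).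
          eapply Rlt_le_trans; [apply Hz; lia|apply Rmin_r]. }
        rewrite <- E in E2. rewrite Rabs_minus_sym in E1.
        pose proof (Rabs_triang (f y c - f z c) (f z c - f (fun i => y (g i)) b)) as T.
        replace (f y c - f z c + (f z c - f (fun i => y (g i)) b))
          with (f y c - f (fun i => y (g i)) b) in T by ring.
        fold d in T. lra.
      + destruct (classic (exists y, O y /\ W y)) as [[y [Oy Wy]]|Hn'].
        * exfalso. apply Hno. exists c, (fun x => O x /\ W x).
          split; [now apply open_inter|]. split; [now exists y|].
          split; [tauto|]. intros x [Ox Wx] Cx Cxg. apply NNPP. intros Hne.
          apply Hn. now exists x.
        * destruct HO as [x Ox]. exists x. split; [easy|].
          destruct (oO x Ox) as [k [e [He H]]]. exists k, e. split; [easy|].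
          intros y Hy Wy _ _. apply Hn'. exists y. split; [now apply H|easy]. }
  destruct (baire_RN _ W (comeager_and _ _ Hgood (comeager_forall _ HD)) oW HW)
    as [x [Wx [gx HDx]]].
  destruct (hom_comp x g Pg) as [q [_ Hq]].
  destruct (HDx (q b)) as [k [e [He H]]].
  apply (H x); auto. now apply near_refl.
Qed.

Lemma transfer_indices W gs b N :
  open_RN W -> (exists x, W x) -> (forall i, (i < N)%nat -> P (gs i)) ->
  exists cs W', open_RN W' /\ (exists x, W' x) /\ (forall x, W' x -> W x) /\
    forall i x, (i < N)%nat -> W' x -> C x -> C (fun a => x (gs i a)) ->
      f x (cs i) = f (fun a => x (gs i a)) b.
Proof.
  intros oW HW. induction N as [|N IH]; intros Hgs.
  - exists (fun _ => O), W. repeat split; auto. intros. lia.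
  - destruct IH as [cs [W1 [o1 [ne1 [H1W H1]]]]]; [auto|].
    destruct (transfer_index W1 (gs N) b o1 ne1) as [c [W2 [o2 [ne2 [H2W H2]]]]]; [auto|].
    exists (fun i => if Nat.eq_dec i N then c else cs i), W2.
    repeat split; auto. intros i x Hi Wx Cx Cxi.
    destruct (Nat.eq_dec i N) as [->|Hne]; [now apply H2|].
    apply H1; auto. lia.
Qed.

(** The reals in [L] are removed one at a time: of two different values of [f _ b], one differs from
    [v], and by continuity this persists nearby. *)
Lemma avoid_values U W g b (L : list R) :
  open_RN W -> (exists x, W x) -> P g -> (forall x, W x -> U (fun i => x (g i))) ->
  (forall U', open_RN U' -> (exists x, U' x) -> (forall x, U' x -> U x) ->
     exists u v, U' u /\ U' v /\ C u /\ C v /\ f u b <> f v b) ->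
  exists W', open_RN W' /\ (exists x, W' x) /\ (forall x, W' x -> W x) /\
    forall x, W' x -> C (fun i => x (g i)) -> ~ In (f (fun i => x (g i)) b) L.
Proof.
  intros oW HW Pg HWU Hnc. induction L as [|v L [W1 [o1 [ne1 [H1W H1]]]]].
  - exists W. repeat split; auto.
  - destruct (ppg_inv P HP g Pg) as [h [_ Hh]].
    assert (Hgh : forall z : RN, (fun i => z (h (g i))) = z)
      by (intros z; now apply comp_inv_l).
    assert (Hhg : forall z : RN, (fun i => z (g (h i))) = z)
      by (intros z; apply comp_inv_l; intros i; split; apply Hh).
    assert (exists u, W1 (fun i => u (h i)) /\ C u /\ f u b <> v) as [u [Wu [Cu Hu]]].
    { destruct (Hnc (fun z => W1 (fun i => z (h i)))) as [u1 [u2 [Wu1 [Wu2 [C1 [C2 Hne]]]]]].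
      - now apply (open_comp h).
      - destruct ne1 as [x Hx]. exists (fun i => x (g i)). now rewrite Hhg.
      - intros z Hz. specialize (HWU _ (H1W _ Hz)). simpl in HWU. now rewrite Hgh in HWU.
      - destruct (classic (f u1 b = v)) as [E|E]; [|now exists u1].
        exists u2. repeat split; auto. congruence. }
    destruct (Hcont b u Cu (Rabs (f u b - v))) as [k [e [He H]]].
    { apply Rabs_pos_lt. lra. }
    exists (fun x => W1 x /\ near k e u (fun i => x (g i))).
    split; [apply open_inter; [easy|]; now apply (open_comp g), near_open|].
    split.
    { exists (fun i => u (h i)). split; [easy|]. rewrite Hgh. now apply near_refl. }
    split; [now intros x [Hx _]; apply H1W|].
    intros x [Wx Hx] Cx [E|Hin]; [|now apply (H1 x)].
    specialize (H _ Cx Hx). rewrite <- E, Rabs_minus_sym in H. lra.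
Qed.

Lemma continuous_on_list C0 f0 (l : list nat) x eps :
  continuous_on C0 f0 -> C0 x -> 0 < eps -> exists k e, 0 < e /\
    forall y, C0 y -> near k e x y -> forall c, In c l -> Rabs (f0 y c - f0 x c) < eps.
Proof.
  intros Hc Cx He. induction l as [|c l [k [e [He' IH]]]].
  - exists O, 1. split; [lra|]. now intros y _ _ c [].
  - destruct (Hc c x Cx eps He) as [k1 [e1 [He1 H1]]].
    exists (max k k1), (Rmin e e1). split; [now apply Rmin_pos|].
    intros y Cy Hy c' [<-|Hin].
    + apply H1; [easy|]. eapply near_weaken; [| |exact Hy]; [lia|apply Rmin_r].
    + apply IH; auto. eapply near_weaken; [| |exact Hy]; [lia|apply Rmin_l].
Qed.

Lemma list_gap (l : list nat) (v : nat -> R) r :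
  (forall c, In c l -> v c <> r) ->
  exists eps, 0 < eps /\ forall c, In c l -> eps <= Rabs (v c - r).
Proof.
  induction l as [|c l IH]; intros H.
  - exists 1. split; [lra|]. now intros c [].
  - destruct IH as [eps [He IH]]; [intros; apply H; now right|].
    assert (0 < Rabs (v c - r)).
    { apply Rabs_pos_lt. specialize (H c (or_introl eq_refl)). lra. }
    exists (Rmin eps (Rabs (v c - r))). split; [now apply Rmin_pos|].
    intros c' [<-|Hin]; [apply Rmin_r|].
    eapply Rle_trans; [apply Rmin_l|auto].
Qed.

Lemma open_forall_lt N (U : nat -> RN -> Prop) :
  (forall i, open_RN (U i)) -> open_RN (fun x => forall i, (i < N)%nat -> U i x).
Proof.
  intros H. induction N as [|N IH].
  - intros x _. exists O, 1. split; [lra|]. intros. lia.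
  - intros x Hx.
    destruct (open_inter _ _ IH (H N) x) as [k [e [He HU]]].
    { split; [intros; apply Hx; lia|apply Hx; lia]. }
    exists k, e. split; [easy|]. intros y Hy i Hi.
    destruct (HU y Hy) as [H1 H2].
    destruct (Nat.eq_dec i N) as [->|Hne]; [easy|apply H1; lia].
Qed.

(** A repeated index is trivially algebraic over the others; if all are distinct, the dimension
    bound applies to the first [S m]. *)
Lemma alg_dim_dependent n (cs : nat -> nat) : alg_dim_le Q n ->
  exists i, (i < S n)%nat /\
    acl Q (fun c => exists j, (j < S n)%nat /\ j <> i /\ c = cs j) (cs i).
Proof.
  intros [m [Hm Hdim]].
  destruct (classic (exists i j, (i < S n)%nat /\ (j < S n)%nat /\ j <> i /\ cs i = cs j))
    as [[i [j [Hi [Hj [Hne E]]]]]|Hinj].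
  - exists i. split; [easy|]. apply acl_incl. now exists j.
  - destruct (Hdim (map cs (seq 0 (S m)))) as [a [Ha Hacl]].
    + apply NoDup_map_NoDup_ForallPairs; [|apply seq_NoDup].
      intros i j Hi Hj E. apply in_seq in Hi. apply in_seq in Hj.
      apply NNPP. intros Hne. apply Hinj. exists i, j. repeat split; auto; lia.
    + now rewrite length_map, length_seq.
    + apply in_map_iff in Ha. destruct Ha as [i [<- Hi]]. apply in_seq in Hi.
      exists i. split; [lia|]. eapply acl_mono; [|exact Hacl].
      intros c [Hc Hne]. apply in_map_iff in Hc. destruct Hc as [j [<- Hj]].
      apply in_seq in Hj. exists j. repeat split; [lia|congruence].
Qed.

Lemma comeager_comps (gs : nat -> nat -> nat) N :
  (forall i, (i < N)%nat -> P (gs i)) ->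
  comeager (fun x => C x /\ forall i, (i < N)%nat -> C (fun a => x (gs i a))).
Proof.
  intros Hgs. apply comeager_and; [easy|].
  apply (comeager_forall (fun i x => (i < N)%nat -> C (fun a => x (gs i a)))).
  intros i. destruct (lt_dec i N) as [Hi|Hi].
  - apply (comeager_mono (fun x => C (fun a => x (gs i a)))); [easy|].
    apply comeager_comp; [|easy]. now apply (ppg_perm P HP), Hgs.
  - apply (comeager_mono C); [|easy]. intros x _ Hi'. lia.
Qed.

(** A permutation of [f x] into [f (x o g)] fixes the indices [cs j], so it moves [cs i] inside a finite orbit. *)
Lemma orbit_values (gs : nat -> nat -> nat) N (cs : nat -> nat) b A U (W : RN -> Prop) i O x g :
  supported C f b A U ->
  (forall x, W x -> forall j, (j < N)%nat -> U (fun a => x (gs j a))) ->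
  (forall j x, (j < N)%nat -> W x -> C x -> C (fun a => x (gs j a)) ->
      f x (cs j) = f (fun a => x (gs j a)) b) ->
  (forall c, orbit (stab Q (fun c => exists j, (j < N)%nat /\ j <> i /\ c = cs j)) (cs i) c ->
     In c O) ->
  P g ->
  (forall j a, (j < N)%nat -> j <> i -> A a -> g (gs j a) = gs j a) ->
  W x -> C x -> (forall j, (j < N)%nat -> C (fun a => x (gs j a))) ->
  W (fun a => x (g a)) -> C (fun a => x (g a)) ->
  (forall j, (j < N)%nat -> C (fun a => x (g (gs j a)))) ->
  exists c, In c O /\ f x (cs i) = f (fun a => x (g a)) c.
Proof.
  intros HS HWU Hcs HO Pg Hfix Wx Cx Cxj Wxg Cxg Cxgj.
  destruct (hom_comp x g Pg) as [q' [Qq' Hq']].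
  destruct (ppg_inv Q HQ q' Qq') as [q [Qq Hq]].
  exists (q (cs i)). split.
  - apply HO. exists q. split; [|easy]. split; [easy|].
    intros c [j [Hj [Hne ->]]].
    assert (Hinj : injective_seq (f x)).
    { apply (Hhom x x). exists (fun a => a). split; [apply (ppg_id P HP)|easy]. }
    (* As [g] fixes the [j]-th copy of the support, [x] and [x o g] yield the same real there;
       injectivity of [f x] turns this into equality of indices. *)
    assert (E : q' (cs j) = cs j).
    { apply Hinj. rewrite Hq', (Hcs j x), (Hcs j (fun a => x (g a))); auto.
      assert (U1 := HWU x Wx j Hj). assert (U2 := HWU (fun a => x (g a)) Wxg j Hj).
      apply (supported_eq C f b A U); auto. }
    rewrite <- E at 1. apply Hq.
  - rewrite <- Hq'. f_equal. symmetry. apply Hq.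
Qed.

Lemma supported_mono b A A' U U' :
  (forall a, A a -> A' a) -> (forall x, U' x -> U x) ->
  supported C f b A U -> supported C f b A' U'.
Proof.
  intros HA HU HS u Uu Cu eps He.
  destruct (HS u (HU u Uu) Cu eps He) as [d [Hd H]]. exists d. split; auto.
Qed.

(** Freeness makes the translates of [A] pairwise disjoint, so [x0] can be copied onto each of
    them. *)
Lemma free_copies (gs : nat -> nat -> nat) N A (x0 : RN) :
  (forall i, (i < N)%nat -> P (gs i)) ->
  (forall i, (i < N)%nat -> forall a, ~ (acl P (img (gs i) A) a /\
     acl P (fun b => exists j, (j < N)%nat /\ j <> i /\ img (gs j) A b) a)) ->
  exists x1 : RN, forall i a, (i < N)%nat -> A a -> x1 (gs i a) = x0 a.
Proof.
  intros Hgs Hfree.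
  destruct (functional_choice
    (fun j r => forall i a, (i < N)%nat -> A a -> j = gs i a -> r = x0 a)) as [x1 H1].
  - intros j. destruct (classic (exists i a, (i < N)%nat /\ A a /\ j = gs i a))
      as [[i [a [Hi [Aa ->]]]]|Hn].
    + exists (x0 a). intros i' a' Hi' Aa' E.
      destruct (Nat.eq_dec i' i) as [->|Hne].
      * f_equal. eapply perm_inj; [|exact E]. now apply (ppg_perm P HP), Hgs.
      * exfalso. apply (Hfree i Hi (gs i a)). split.
        -- apply acl_incl. now exists a.
        -- apply acl_incl. exists i'. repeat split; auto. now exists a'.
    + exists 0. intros i a Hi Aa E. exfalso. apply Hn. now exists i, a.
  - exists x1. intros i a Hi Aa. now apply (H1 _ i).
Qed.

Section LocallyConstant.
Variable n : nat.
Hypothesis Hdim : alg_dim_le Q n.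
Hypothesis Hfree : n_free P (S n).

(** The [S n] reals [f (x o gs i) b] occur in [f x] at indices [cs i], one of which is algebraic over the
    others. If the [i]-th is, it takes finitely many values as [x] varies off the closure [B] of the
    supports of the others; but its own support is disjoint from [B]. *)
Lemma locally_constant b U0 : open_RN U0 -> (exists x, U0 x) ->
  exists U, open_RN U /\ (exists x, U x) /\ (forall x, U x -> U0 x) /\
    forall u v, U u -> U v -> C u -> C v -> f u b = f v b.
Proof.
  intros oU0 HU0. apply NNPP. intros Hno.
  destruct (supported_dense U0 b oU0 HU0) as [A0 [U1 [fA0 [_ [oU1 [[x0 Ux0] [HU10 HS0]]]]]]].
  destruct (oU1 x0 Ux0) as [k [e [He HU1]]].
  set (U := near k e x0).
  (* [A] also contains the coordinates defining [U], so a copy of [x0] on a translate of [A]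
     suffices to enter [U]. *)
  set (A := acl P (fun a => A0 a \/ (a < k)%nat)).
  assert (fA : finite_nat A) by (apply Hlf, finite_union; [easy|apply finite_lt]).
  assert (HS : supported C f b A U).
  { apply (supported_mono b A0 A U1 U); auto.
    intros a Ha. apply acl_incl. now left. }
  assert (Hnc : forall U', open_RN U' -> (exists x, U' x) -> (forall x, U' x -> U x) ->
     exists u v, U' u /\ U' v /\ C u /\ C v /\ f u b <> f v b).
  { intros U' oU' neU' HU'. apply NNPP. intros Hn. apply Hno. exists U'.
    do 2 (split; [easy|]). split; [intros x Hx; now apply HU10, HU1, HU'|].
    intros u v Uu Uv Cu Cv. apply NNPP. intros Hne. apply Hn. now exists u, v. }
  destruct (Hfree A fA) as [gs [Pgs Hgs]].
  destruct (free_copies gs (S n) A x0 Pgs Hgs) as [x1 Hx1].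
  set (W0 := fun x : RN => forall i, (i < S n)%nat -> U (fun a => x (gs i a))).
  destruct (transfer_indices W0 gs b (S n)) as [cs [W1 [oW1 [[z1 Wz1] [HW10 Hcs]]]]].
  { apply open_forall_lt. intros i. apply (open_comp (gs i)), near_open. }
  { exists x1. intros i Hi a Ha. rewrite Hx1; [|easy|].
    - now apply (near_refl k).
    - apply acl_incl. now right. }
  { exact Pgs. }
  destruct (oW1 z1 Wz1) as [kW [eW [HeW HW1]]].
  (* A box, so that mixing the coordinates of two points of [W] stays in [W]. *)
  set (W := near kW eW z1).
  assert (oW : open_RN W) by apply near_open.
  assert (neW : exists x, W x) by (exists z1; now apply near_refl).
  assert (HWU : forall x, W x -> forall j, (j < S n)%nat -> U (fun a => x (gs j a)))
    by (intros x Wx; now apply HW10, HW1).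
  destruct (alg_dim_dependent n cs Hdim) as [i [Hi [O HO]]].
  set (C' := fun x => C x /\ forall j, (j < S n)%nat -> C (fun a => x (gs j a))).
  assert (HC' : comeager C') by now apply comeager_comps.
  set (B := acl P (fun c => exists j, (j < S n)%nat /\ j <> i /\ img (gs j) A c)).
  assert (fB0 : finite_nat (fun c => exists j, (j < S n)%nat /\ j <> i /\ img (gs j) A c)).
  { eapply finite_subset; [|apply (finite_bigunion (S n) (fun j => img (gs j) A))].
    - intros c [j [Hj [_ Hc]]]. now exists j.
    - intros j. now apply finite_img. }
  destruct (baire_RN C' W HC' oW neW) as [z0 [Wz0 Cz0]].
  (* At the indices in [O], [f z0] has finitely many values; non-constancy provides points whose
     [i]-th real is none of them. *)
  destruct (avoid_values U W (gs i) b (map (f z0) O) oW neW (Pgs i Hi))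
    as [W2 [oW2 [neW2 [HW2 Hav]]]]; [now intros x Wx; apply HWU|exact Hnc|].
  destruct (baire_RN C' W2 HC' oW2 neW2) as [w [Ww [Cw Cwj]]].
  set (r := f (fun a => w (gs i a)) b).
  destruct (list_gap O (f z0) r) as [eps [Heps Hgap]].
  { intros c Hc E. apply (Hav w Ww (Cwj i Hi)). rewrite in_map_iff. now exists c. }
  destruct (continuous_on_list C f O z0 (eps / 2) Hcont (proj1 Cz0) ltac:(lra))
    as [kz [ez [Hez Hz]]].
  destruct (HS (fun a => w (gs i a))) with (eps := eps / 2) as [d [Hd Hsup]];
    [apply HWU; auto|auto|lra|].
  destruct (finite_img (gs i) A fA) as [lK HlK].
  destruct (finite_bounded lK) as [K HK].
  (* The [i]-th copy comes from [w] and all the rest from [z0]; by freeness the rest includes [B],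
     so amalgamation over [B] applies to [w'] and [z0]. *)
  set (w' := fun j => if excluded_middle_informative (img (gs i) A j) then w j else z0 j).
  assert (Ww' : W w').
  { intros j Hj. unfold w'. destruct (excluded_middle_informative _).
    - now apply (HW2 w Ww).
    - now apply Wz0. }
  destruct (amalgamation P HP Hlf B (fun x => W x /\ near K d w' x)
    (fun x => W x /\ near kz ez z0 x) w' z0) as [g [x [[Pg Hg] [Hx1' Hx2]]]].
  { now apply Hlf. }
  { intros a. now apply acl_idem. }
  { apply open_inter; [easy|apply near_open]. }
  { apply open_inter; [easy|apply near_open]. }
  { split; [easy|now apply near_refl]. }
  { split; [easy|now apply near_refl]. }
  { intros a Ba. unfold w'. destruct (excluded_middle_informative _) as [Ha|Ha]; [|easy].
    exfalso. apply (Hgs i Hi a). split; [|exact Ba]. now apply acl_incl. }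
  destruct (baire_RN (fun v => C' v /\ C' (fun a => v (g a)))
    (fun v => (W v /\ near K d w' v) /\
              (W (fun a => v (g a)) /\ near kz ez z0 (fun a => v (g a)))))
    as [v [[[Wv Hv] [Wvg Hvg]] [[Cv Cvj] [Cvg Cvgj]]]].
  { apply comeager_and; [easy|]. apply comeager_comp; [|easy]. now apply (ppg_perm P HP). }
  { apply open_inter.
    - apply open_inter; [easy|apply near_open].
    - apply (open_comp g (fun z => W z /\ near kz ez z0 z)).
      apply open_inter; [easy|apply near_open]. }
  { now exists x. }
  destruct (orbit_values gs (S n) cs b A U W i O v g) as [c [Hc E]]; auto.
  { intros j a Hj Hne Aa. apply Hg. apply acl_incl.
    exists j. repeat split; auto. now exists a. }
  (* The [i]-th real is near [r], since [v] is close to [w] on its support; but by [E] it is also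
     near a value of [f z0] on [O], against the gap. *)
  assert (E1 : Rabs (f v (cs i) - r) < eps / 2).
  { rewrite (Hcs i v); auto. apply Hsup; auto.
    intros a Aa. assert (Hia : img (gs i) A (gs i a)) by now exists a.
    assert (Ew : w (gs i a) = w' (gs i a)).
    { unfold w'. now destruct (excluded_middle_informative _). }
    rewrite Ew. apply Hv, HK, HlK. exact Hia. }
  assert (E2 : Rabs (f (fun a => v (g a)) c - f z0 c) < eps / 2) by now apply Hz.
  specialize (Hgap c Hc). rewrite E in E1. rewrite Rabs_minus_sym in E2.
  pose proof (Rabs_triang (f z0 c - f (fun a => v (g a)) c) (f (fun a => v (g a)) c - r)) as T.
  replace (f z0 c - f (fun a => v (g a)) c + (f (fun a => v (g a)) c - r))
    with (f z0 c - r) in T by ring.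
  lra.
Qed.

End LocallyConstant.
End Homomorphism.

(** * Generic ergodicity *)

Definition rat (n : nat) : R :=
  let (a, m) := of_nat n in let (p, q) := of_nat a in (INR p - INR q) / INR (S m).

Lemma rat_dense r eps : 0 < eps -> exists n, Rabs (rat n - r) < eps.
Proof.
  intros He. destruct (archimed_cor1 eps He) as [M [HM HM0]].
  assert (HMR : 0 < INR M) by now apply lt_0_INR.
  destruct (archimed (r * INR M)) as [Hz1 Hz2]. set (z := up (r * INR M)) in *.
  (* The integer [z] is coded as a difference of naturals; [pred M] compensates for the successor in
     the denominator of [rat]. *)
  exists (to_nat (to_nat (Z.to_nat z, Z.to_nat (- z)), pred M)).
  unfold rat. rewrite !cancel_of_to.
  replace (INR (Z.to_nat z) - INR (Z.to_nat (- z))) with (IZR z).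
  2:{ rewrite !INR_IZR_INZ, <- minus_IZR. f_equal. lia. }
  replace (S (pred M)) with M by lia.
  replace (IZR z / INR M - r) with ((IZR z - r * INR M) * / INR M) by (field; lra).
  assert (HiM : 0 < / INR M) by now apply Rinv_0_lt_compat.
  rewrite Rabs_pos_eq; [|apply Rmult_le_pos; lra].
  eapply Rle_lt_trans; [|exact HM]. rewrite <- (Rmult_1_l (/ INR M)) at 2.
  apply Rmult_le_compat_r; lra.
Qed.

(** The length is supplied separately, as the number alone never signals the end of the list. *)
Fixpoint decode_length (k n : nat) : list nat :=
  match k with
  | O => nil
  | S k => let (a, m) := of_nat n in a :: decode_length k m
  end.

Definition decode_list (n : nat) : list nat :=
  let (k, m) := of_nat n in decode_length k m.

Lemma decode_list_surj l : exists n, decode_list n = l.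
Proof.
  assert (H : exists m, decode_length (length l) m = l).
  { induction l as [|a l [m IH]]; [now exists O|].
    exists (to_nat (a, m)). simpl length. cbn [decode_length].
    now rewrite cancel_of_to, IH. }
  destruct H as [m Hm]. exists (to_nat (length l, m)).
  unfold decode_list. now rewrite cancel_of_to.
Qed.

Lemma decode_list_fun (c : nat -> nat) k :
  exists n, length (decode_list n) = k /\
    forall i, (i < k)%nat -> nth i (decode_list n) O = c i.
Proof.
  destruct (decode_list_surj (map c (seq 0 k))) as [n Hn].
  exists n. rewrite Hn, length_map, length_seq. split; [easy|]. intros i Hi.
  rewrite (nth_indep _ O (c O)) by now rewrite length_map, length_seq.
  rewrite map_nth, seq_nth by easy. reflexivity.
Qed.

Definition base (n : nat) : RN -> Prop :=
  let (a, m) := of_nat n in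
  near (length (decode_list a)) (/ INR (S m)) (fun i => rat (nth i (decode_list a) O)).

Lemma base_open n : open_RN (base n).
Proof. unfold base. destruct (of_nat n). apply near_open. Qed.

Lemma base_spec U x : open_RN U -> U x ->
  exists n, base n x /\ forall y, base n y -> U y.
Proof.
  intros oU Ux. destruct (oU x Ux) as [k [e [He HU]]].
  destruct (archimed_cor1 (e / 2) ltac:(lra)) as [M [HM HM0]].
  assert (HiM : 0 < / INR M) by now apply Rinv_0_lt_compat, lt_0_INR.
  destruct (functional_choice _ (fun i => rat_dense (x i) (/ INR M) HiM)) as [c Hc].
  destruct (decode_list_fun c k) as [a [Hlen Hnth]].
  exists (to_nat (a, pred M)). unfold base. rewrite cancel_of_to, Hlen.
  replace (S (pred M)) with M by lia.
  assert (Hx : near k (/ INR M) (fun i => rat (nth i (decode_list a) O)) x).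
  { intros i Hi. rewrite Hnth by easy. rewrite Rabs_minus_sym. apply Hc. }
  split; [exact Hx|]. intros y Hy. apply HU.
  apply (near_weaken k k e (/ INR M + / INR M)); [lia|lra|].
  eapply near_trans; [|exact Hy]. now apply near_sym.
Qed.

(** Choose one element of [P] for each finite list of initial values that is realized in [P]. *)
Lemma countable_dense_subset P : polish_perm_group P ->
  exists gam : nat -> nat -> nat, (forall m, P (gam m)) /\
    forall g k, P g -> exists m, agree k g (gam m).
Proof.
  intros HP.
  destruct (functional_choice (fun n h => P h /\
    forall g, P g -> (forall i, (i < length (decode_list n))%nat ->
                        nth i (decode_list n) O = g i) ->
      agree (length (decode_list n)) g h)) as [gam Hgam].
  - intros n. destruct (classic (exists g, P g /\ forall i,
      (i < length (decode_list n))%nat -> nth i (decode_list n) O = g i))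
      as [[g [Pg Hg]]|Hn].
    + exists g. split; [easy|]. intros g' _ Hg' i Hi. now rewrite <- Hg, <- Hg'.
    + exists (fun i => i). split; [apply (ppg_id P HP)|].
      intros g Pg Hg. exfalso. apply Hn. now exists g.
  - exists gam. split; [apply Hgam|]. intros g k Pg.
    destruct (decode_list_fun g k) as [m [Hlen Hnth]]. exists m.
    destruct (Hgam m) as [_ H]. rewrite Hlen in H. now apply H.
Qed.

(** Preimages of the countably many slabs with rational bounds agree with open sets off meager sets;
    [C] is the set where all of them agree. *)
Lemma baire_measurable_continuous f : baire_measurable_to_inj f ->
  exists C, comeager C /\ continuous_on C f.
Proof.
  intros [_ Hf].
  set (V := fun b p q (y : RN) => rat p < y b < rat q).
  assert (HV : forall n, exists U, open_RN U /\ comeager (fun x =>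
    (V (fst (of_nat n)) (fst (of_nat (snd (of_nat n)))) (snd (of_nat (snd (of_nat n)))) (f x)
     <-> U x))).
  { intros n. apply Hf. set (b := fst _). set (p := fst _). set (q := snd (of_nat _)).
    intros y [Hp Hq]. exists (S b), (Rmin (y b - rat p) (rat q - y b)).
    split; [apply Rmin_pos; lra|]. intros z Hz. specialize (Hz b ltac:(lia)).
    pose proof (Rmin_l (y b - rat p) (rat q - y b)).
    pose proof (Rmin_r (y b - rat p) (rat q - y b)).
    apply Rabs_def2 in Hz. unfold V. lra. }
  destruct (functional_choice _ HV) as [U HU].
  exists (fun x => forall n,
    (V (fst (of_nat n)) (fst (of_nat (snd (of_nat n)))) (snd (of_nat (snd (of_nat n)))) (f x)
     <-> U n x)).
  split; [apply comeager_forall; intros n; apply HU|].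
  intros b x Cx eps He.
  destruct (rat_dense (f x b - eps / 2) (eps / 2) ltac:(lra)) as [p Hp].
  destruct (rat_dense (f x b + eps / 2) (eps / 2) ltac:(lra)) as [q Hq].
  apply Rabs_def2 in Hp. apply Rabs_def2 in Hq.
  set (n := to_nat (b, to_nat (p, q))).
  assert (Ux : U n x).
  { apply Cx. unfold n. rewrite !cancel_of_to. cbn [fst snd]. rewrite cancel_of_to.
    cbn [fst snd]. unfold V. lra. }
  destruct (proj1 (HU n) x Ux) as [k [e [He' H]]]. exists k, e. split; [easy|].
  intros y Cy Hy. assert (Vy := proj2 (Cy n) (H y Hy)).
  unfold n in Vy. rewrite !cancel_of_to in Vy. cbn [fst snd] in Vy.
  rewrite cancel_of_to in Vy. cbn [fst snd] in Vy. unfold V in Vy.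
  apply Rabs_def1; lra.
Qed.

(** Translates of the empty set are empty, so freeness makes its closure disjoint from itself; the
    count [S n] guarantees an index to apply this to. *)
Lemma free_acl_empty P n a : n_free P (S n) -> ~ acl P (fun _ => False) a.
Proof.
  intros H Ha. destruct (H (fun _ => False)) as [gs [_ Hgs]]; [now exists nil|].
  apply (Hgs O ltac:(lia) a). split; (eapply acl_mono; [|exact Ha]); easy.
Qed.

(** The empty set is algebraically closed, so any two open conditions can be amalgamated over it. *)
Lemma free_orbit_dense P n U : polish_perm_group P -> locally_finite P ->
  n_free P (S n) -> open_RN U -> (exists z, U z) ->
  dense_RN (fun x => exists g, P g /\ U (fun i => x (g i))).
Proof.
  intros HP Hlf Hfree oU [z Uz] O oO [y Oy].
  destruct (amalgamation P HP Hlf (fun _ => False) O U y z) as [g [x [[Pg _] [Ox Ux]]]]; auto.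
  - now exists nil.
  - intros a. now apply free_acl_empty with (n := n).
  - easy.
  - exists x. split; [easy|]. now exists g.
Qed.

(** Two generic points have images with the same finite initial parts up to [Q], and [Q] is closed. *)
Lemma generic_ergodicity n P Q :
  polish_perm_group P -> polish_perm_group Q ->
  alg_dim_le Q n -> locally_finite P -> n_free P (S n) ->
  generically_ergodic_inj P Q.
Proof.
  intros HP HQ Hdim Hlf Hfree f Hf Hhom.
  assert (Hinj := proj1 Hf : forall x, injective_seq (f x)).
  destruct (baire_measurable_continuous f Hf) as [C [HC Hcont]].
  destruct (countable_dense_subset P HP) as [gam [Pgam Hgam]].
  set (const := fun b x => exists U, open_RN U /\ U x /\
    forall u v, U u -> U v -> C u -> C v -> f u b = f v b).
  (* Generic points: [x] and its translates by the [gam m] lie in [C], each entry of [f] is constant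
     on [C] near [x], and those translates meet every nonempty basic open set. *)
  set (G := fun x => (C x /\ forall m, C (fun i => x (gam m i))) /\
    ((forall b, const b x) /\
     forall k, (exists z, base k z) -> exists m, base k (fun i => x (gam m i)))).
  assert (HG : comeager G).
  { apply comeager_and; apply comeager_and; [easy| | |].
    - apply comeager_forall. intros m.
      apply comeager_comp; [|easy]. now apply (ppg_perm P HP).
    - apply comeager_forall. intros b. apply dense_open_comeager1.
      + intros x [U [oU [Ux HU]]]. destruct (oU x Ux) as [k [e [He H]]].
        exists k, e. split; [easy|]. intros y Hy. exists U. auto.
      + intros O oO HO.
        destruct (locally_constant P Q HP HQ Hlf f Hhom C HC Hcont n Hdim Hfree b O oO HO)
          as [U [oU [[x Ux] [HUO HU]]]].
        exists x. split; [auto|]. now exists U.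
    - apply (comeager_forall (fun k x =>
        (exists z, base k z) -> exists m, base k (fun i => x (gam m i)))).
      intros k. destruct (classic (exists z, base k z)) as [Hk|Hk].
      2:{ apply (comeager_mono C); [|easy]. intros x _ Hk'. easy. }
      apply (comeager_mono (fun x => exists m, base k (fun i => x (gam m i)))); [easy|].
      apply dense_open_comeager1.
      + intros x [m Hm].
        destruct (open_comp (gam m) _ (base_open k) x Hm) as [k' [e [He H]]].
        exists k', e. split; [easy|]. intros y Hy. exists m. now apply H.
      + intros O oO HO.
        destruct (free_orbit_dense P n _ HP Hlf Hfree (base_open k) Hk O oO HO)
          as [x [Ox [g [Pg Hx]]]].
        exists x. split; [easy|].
        destruct (open_near_comp _ x g (base_open k) Hx) as [K [e [He H]]].
        destruct (Hgam g K Pg) as [m Hm]. exists m. apply H; [|easy].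
        now apply near_refl. }
  assert (Hfin : forall x x0 k, G x -> G x0 ->
    exists q, Q q /\ forall i, (i < k)%nat -> f x0 (q i) = f x i).
  { intros x x0 k [[Cx _] [Hx _]] [[_ Cx0] [_ Hx0]].
    destruct (functional_choice _ Hx) as [U HU].
    (* Near [x] the first [k] entries of [f] are constant on [C]. Some translate of [x0] enters this
       neighbourhood, and its image is [f x0] composed with an element of [Q]. *)
    destruct (base_spec (fun y => forall i, (i < k)%nat -> U i y) x) as [l [Hl HlU]].
    - apply open_forall_lt. intros i. apply HU.
    - intros i _. apply HU.
    - destruct (Hx0 l) as [m Hm]; [now exists x|].
      destruct (hom_comp P Q f Hhom x0 (gam m) (Pgam m)) as [q [Qq Hq]].
      exists q. split; [easy|]. intros i Hi. rewrite Hq.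
      destruct (HU i) as [_ [Ux Hc]]. apply Hc; auto. }
  destruct (baire_RN G (fun _ => True) HG) as [x0 [_ Gx0]].
  { intros x _. exists O, 1. split; [lra|easy]. }
  { now exists (fun _ => 0). }
  exists G, (f x0). split; [easy|]. split; [apply Hinj|].
  intros x Gx. split; [apply Hinj|]. split; [apply Hinj|].
  (* Entries of [f x] occur in [f x0] and conversely; by injectivity this determines a permutation
     [t], which agrees with elements of [Q] on initial segments. *)
  assert (Hsub : forall x x0, G x -> G x0 -> forall i, exists j, f x0 j = f x i).
  { intros y y0 Gy Gy0 i. destruct (Hfin y y0 (S i) Gy Gy0) as [q [_ Hq]].
    exists (q i). apply Hq. lia. }
  destruct (functional_choice _ (Hsub x x0 Gx Gx0)) as [t Ht].
  exists t. split; [|exact Ht]. apply (ppg_closed Q HQ).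
  - apply bij_is_perm.
    + intros i j E. apply (Hinj x). now rewrite <- !Ht, E.
    + intros i. destruct (Hsub x0 x Gx0 Gx i) as [j Hj]. exists j.
      apply (Hinj x0). now rewrite Ht.
  - intros k. destruct (Hfin x x0 k Gx Gx0) as [q [Qq Hq]].
    exists q. split; [easy|]. intros i Hi. apply (Hinj x0). now rewrite Hq, Ht.
Qed.

(** * Baire property of Borel sets, and non-reducibility *)

Lemma comeager_full : comeager (fun _ => True).
Proof.
  apply dense_open_comeager1.
  - intros x _. exists O, 1. split; [lra|easy].
  - intros U _ [x Ux]. now exists x.
Qed.

Lemma borel_baire_property B : borel_RN B -> baire_property B.
Proof.
  induction 1 as [U oU|B _ [U [oU HU]]|Bs _ IH].
  - exists U. split; [easy|].
    apply (comeager_mono (fun _ => True) (fun x => U x <-> U x)); [easy|apply comeager_full].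
  (* The complement is approximated by the exterior of [U], because [U] and its exterior together
     are open and dense. *)
  - set (U' := fun x => exists k e, 0 < e /\ forall y, near k e x y -> ~ U y).
    assert (oU' : open_RN U').
    { intros x [k [e [He H]]]. exists k, (e / 2). split; [lra|].
      intros y Hy. exists k, (e / 2). split; [lra|]. intros z Hz. apply H.
      replace e with (e / 2 + e / 2) by field. now apply (near_trans k _ _ x y z). }
    exists U'. split; [easy|].
    apply (comeager_mono (fun x => (B x <-> U x) /\ (U x \/ U' x)) (fun x => ~ B x <-> U' x)).
    + intros x [HB HUU]. split; [tauto|]. intros [k [e [He H]]].
      rewrite HB. apply H. now apply near_refl.
    + apply comeager_and; [exact HU|]. apply dense_open_comeager1.
      * intros x [Ux|Ux].
        -- destruct (oU x Ux) as [k [e [He H]]]. exists k, e. auto.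
        -- destruct (oU' x Ux) as [k [e [He H]]]. exists k, e. auto.
      * intros O oO [x Ox]. destruct (classic (exists y, O y /\ U y)) as [[y [Oy Uy]]|Hn].
        -- exists y. auto.
        -- exists x. split; [easy|]. right.
           destruct (oO x Ox) as [k [e [He H]]]. exists k, e. split; [easy|].
           intros y Hy Uy. apply Hn. exists y. split; [now apply H|easy].
  - destruct (functional_choice _ IH) as [U HU].
    exists (fun x => exists k, U k x). split.
    + intros x [k Ux]. destruct (proj1 (HU k) x Ux) as [k' [e [He H]]].
      exists k', e. split; [easy|]. intros y Hy. exists k. now apply H.
    + apply (comeager_mono (fun x => forall k, Bs k x <-> U k x)
        (fun x => (exists k, Bs k x) <-> exists k, U k x)).
      * intros x H. split; intros [k Hk]; exists k; now apply H.
      * apply comeager_forall. intros k. apply HU.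
Qed.

(** Equivalent sequences have the same entries, but the first entry of a generic [x] differs from
    every entry of a fixed [x0]. *)
Lemma class_not_comeager P (C : RN -> Prop) :
  comeager C -> (forall x x', C x -> C x' -> E_bern P x x') -> False.
Proof.
  intros HC H.
  assert (oT : open_RN (fun _ => True)) by (intros x _; exists O, 1; split; [lra|easy]).
  destruct (baire_RN C (fun _ => True) HC oT) as [x0 [_ Cx0]]; [now exists (fun _ => 0)|].
  assert (HD : comeager (fun x => forall n, x O <> x0 n)).
  { apply comeager_forall. intros n. apply dense_open_comeager1.
    - intros x Hx. exists 1%nat, (Rabs (x O - x0 n)).
      split; [apply Rabs_pos_lt; lra|]. intros y Hy E.
      specialize (Hy O ltac:(lia)). rewrite E, Rabs_minus_sym in Hy. lra.
    - intros U oU [x Ux]. destruct (oU x Ux) as [k [e [He HU]]].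
      destruct (classic (x O = x0 n)) as [E|E]; [|now exists x].
      exists (fun i => match i with O => x O + e / 2 | _ => x i end).
      split; [|lra]. apply HU. intros [|i] Hi.
      + replace (x O + e / 2 - x O) with (e / 2) by ring. rewrite Rabs_pos_eq; lra.
      + now apply (near_refl k). }
  destruct (baire_RN _ (fun _ => True) (comeager_and _ _ HC HD) oT)
    as [x [_ [Cx Hx]]]; [now exists (fun _ => 0)|].
  destruct (H x x0 Cx Cx0) as [g [_ Hg]].
  apply (Hx (g O)). symmetry. apply Hg.
Qed.

Theorem theorem1p2 (n : nat) (P Q : (nat -> nat) -> Prop) :
  polish_perm_group P -> polish_perm_group Q ->
  alg_dim_le Q n -> locally_finite P -> n_free P (S n) ->
  generically_ergodic_inj P Q /\ ~ borel_reducible_inj P Q.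
Proof.
  intros HP HQ Hdim Hlf Hfree.
  assert (Herg := generic_ergodicity n P Q HP HQ Hdim Hlf Hfree).
  split; [exact Herg|]. intros [f [[Hinj Hborel] Hred]].
  destruct (Herg f) as [C [y0 [HC [_ HCy]]]].
  - split; [easy|]. intros V oV. now apply borel_baire_property, Hborel.
  - intros x x'. apply Hred.
  (* The images of [C] lie in one class, so the reduction would put [C] inside a single class of
     [E_bern P]. *)
  - apply (class_not_comeager P C HC). intros x x' Cx Cx'. apply Hred.
    split; [apply Hinj|]. split; [apply Hinj|].
    destruct (HCy x Cx) as [_ [_ [g [Qg Hg]]]].
    destruct (HCy x' Cx') as [_ [_ [h [Qh Hh]]]].
    destruct (ppg_inv Q HQ h Qh) as [h' [Qh' Hh']].
    exists (fun b => h' (g b)). split; [now apply (ppg_comp Q HQ)|].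
    intros b. rewrite <- Hg, <- (Hh (h' (g b))). f_equal. apply Hh'.
Qed.
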